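(* Let $p\ge 2$ and $q=e^{\pi i/p}$. For $1\le s\le p-1$ the space of symmetric linear functions of $B_s$ is $3$-dimensional, and for $s=0$ and $s=p$ the space of symmetric linear functions of $B_s$ is $1$-dimensional.
   Context: A symmetric linear function of a finite-dimensional associative unital $\mathbb{C}$-algebra $A$ is a linear map $\varphi:A\to\mathbb{C}$ with $\varphi(ab)=\varphi(ba)$ for all $a,b\in A$. $\overline{U}_q=\overline{U}_qsl_2(\mathbb{C})$ is the associative unital $\mathbb{C}$-algebra generated by $E,F,K$ with relations $E^p=F^p=0$, $K^{2p}=1$, $KEK^{-1}=q^2E$, $KFK^{-1}=q^{-2}F$, $EF-FE=\frac{K-K^{-1}}{q-q^{-1}}$. Put $[n]=\frac{q^n-q^{-n}}{q-q^{-1}}$. Upper signs go together and lower signs go together; empty products are $1$, empty sums are $0$. For $1\le s\le p$ put $v_s^{\pm}=\sum_{\ell=0}^{2p-1}(\pm q^{-(s-1)})^{\ell}K^{\ell}$ and $a_0^{\pm}(s)=E^{p-1}F^{p-1}v_s^{\pm}$. For $1\le s\le p-1$ put $$\alpha_n^{\pm}(s)=\prod_{k=p-s-(n-1)}^{p-s-1}(\mp[k][p-s-k]),\qquad b_0^{\pm}(s)=\sum_{n=1}^{p-s}\alpha_n^{\pm}(s)E^{p-1-n}F^{p-1-n}v_s^{\pm},$$ $$\gamma^{\pm}(s)=2p\prod_{m=1}^{p-s-1}(\mp[m][p-s-m])\prod_{i=1}^{s-1}(\pm[i][s-i]),$$ $$\delta^{\pm}(s)=2p\prod_{m=1}^{p-s-1}(\mp[m][p-s-m])\sum_{j=1}^{s-1}\prod_{1\le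 k\le s-1,\,k\ne j}(\pm[k][s-k])+2p\prod_{i=1}^{s-1}(\pm[i][s-i])\sum_{n=1}^{p-s-1}\prod_{1\le k\le p-s-1,\,k\ne n}(\mp[k][p-s-k]).$$ Then $$e_s^{\pm}=\frac{1}{\gamma^{\pm}(s)}\Big(b_0^{\pm}(s)-\frac{\delta^{\pm}(s)}{\gamma^{\pm}(s)}a_0^{\pm}(s)\Big)\ (1\le s\le p-1),\qquad e_p^{\pm}=\frac{1}{2p\prod_{i=1}^{p-1}(\pm[i][p-i])}a_0^{\pm}(p)$$ are primitive idempotents of $\overline{U}_q$. The Casimir element $C=EF+\frac{q^{-1}K+qK^{-1}}{(q-q^{-1})^2}$ is central, with minimal polynomial $(x-\beta_0)(x-\beta_p)\prod_{j=1}^{p-1}(x-\beta_j)^2$, $\beta_j=\frac{q^j+q^{-j}}{(q-q^{-1})^2}$. Accordingly $\overline{U}_q=\bigoplus_{s=0}^{p}\mathcal{Q}_s$, where $\mathcal{Q}_s$ is the subalgebra (two-sided ideal) of $\overline{U}_q$ on which $C$ has the (generalized) eigenvalue $\beta_s$. One has $e_s^{+},e_{p-s}^{-}\in\mathcal{Q}_s$ for $1\le s\le p-1$, $e_p^-\in\mathcal{Q}_0$, $e_p^+\in\mathcal{Q}_p$. Put $B_s=(e_s^{+}+e_{p-s}^{-})\mathcal{Q}_s(e_s^{+}+e_{p-s}^{-})$ for $1\le s\le p-1$, $B_0=e_p^{-}\mathcal{Q}_0e_p^{-}$ and $B_p=e_p^{+}\mathcal{Q}_pe_p^{+}$ (the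 basic algebras of the $\mathcal{Q}_s$). *)

(* Defs.v *)
From HB Require Import structures.
From mathcomp Require Import all_boot all_order all_algebra.
From mathcomp Require Import boolp classical_sets reals trigo.
From mathcomp Require Import complex.

Set Implicit Arguments.
Unset Strict Implicit.
Unset Printing Implicit Defensive.

Import Order.TTheory GRing.Theory Num.Theory.

Local Open Scope ring_scope.
Local Open Scope classical_set_scope.

(* Unital associative k-algebra presented by generators X and relations rel: *)
(* formal expressions modulo the smallest congruence that contains rel and   *)
(* the axioms of unital associative k-algebras.                              *)

Inductive term (k X : Type) : Type :=
| Gen of X
| Cst of k
| Add of term k X & term k X
| Mul of term k X & term k X.

Arguments Gen {k X}.
Arguments Cst {k X}.

HB.instance Definition _ (k X : Type) := gen_eqMixin (term k X).
HB.instance Definition _ (k X : Type) := gen_choiceMixin (term k X).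

Fixpoint Exp (k : nzRingType) (X : Type) (t : term k X) (n : nat) : term k X :=
  if n is m.+1 then Mul t (Exp t m) else Cst 1.

Section Presentation.
Variables (k : fieldType) (X : Type).
Local Notation tm := (term k X).
Variable rel : tm -> tm -> Prop.

Inductive cong : tm -> tm -> Prop :=
| cong_rel t u : rel t u -> cong t u
| cong_refl t : cong t t
| cong_sym t u : cong t u -> cong u t
| cong_trans t u v : cong t u -> cong u v -> cong t v
| cong_add t t' u u' : cong t t' -> cong u u' -> cong (Add t u) (Add t' u')
| cong_mul t t' u u' : cong t t' -> cong u u' -> cong (Mul t u) (Mul t' u')
| cong_addA t u v : cong (Add t (Add u v)) (Add (Add t u) v)
| cong_addC t u : cong (Add t u) (Add u t)
| cong_add0 t : cong (Add (Cst 0) t) t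
| cong_addN t : cong (Add (Mul (Cst (-1)) t) t) (Cst 0)
| cong_mulA t u v : cong (Mul t (Mul u v)) (Mul (Mul t u) v)
| cong_mul1l t : cong (Mul (Cst 1) t) t
| cong_mul1r t : cong (Mul t (Cst 1)) t
| cong_mulDl t u v : cong (Mul (Add t u) v) (Add (Mul t v) (Mul u v))
| cong_mulDr t u v : cong (Mul t (Add u v)) (Add (Mul t u) (Mul t v))
| cong_cstD a b : cong (Cst (a + b)) (Add (Cst a) (Cst b))
| cong_cstM a b : cong (Cst (a * b)) (Mul (Cst a) (Cst b))
| cong_cstC a t : cong (Mul (Cst a) t) (Mul t (Cst a)).

Definition congb (t u : tm) : bool := `[< cong t u >].

Lemma congb_refl : reflexive congb.
Proof. by move=> t; apply/asboolP; exact: cong_refl. Qed.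

Lemma congb_sym : symmetric congb.
Proof. by move=> t u; apply/asboolP/asboolP; exact: cong_sym. Qed.

Lemma congb_trans : transitive congb.
Proof.
by move=> u t v /asboolP tu /asboolP uv; apply/asboolP; exact: cong_trans uv.
Qed.

Canonical congb_equiv := EquivRel congb congb_refl congb_sym congb_trans.

Definition palg : Type := {eq_quot congb}%qT.
HB.instance Definition _ := Choice.on palg.

Definition cls (t : tm) : palg := (\pi_({eq_quot congb}) t)%qT.
Definition rep (x : palg) : tm := (repr (x : {eq_quot congb}))%qT.

Lemma repK x : cls (rep x) = x.
Proof. exact: reprK. Qed.

Lemma clsP t u : cls t = cls u <-> cong t u.
Proof.
split=> [/eqP|tu]; first by rewrite /cls eqmodE => /asboolP.
by apply/eqP; rewrite /cls eqmodE; apply/asboolP.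
Qed.

Lemma rep_cls t : cong (rep (cls t)) t.
Proof. by apply/clsP; rewrite repK. Qed.

Definition pzero := cls (Cst 0).
Definition pone := cls (Cst 1).
Definition padd x y := cls (Add (rep x) (rep y)).
Definition pmul x y := cls (Mul (rep x) (rep y)).
Definition popp x := cls (Mul (Cst (-1)) (rep x)).
Definition pscale a x := cls (Mul (Cst a) (rep x)).

Lemma padd_cls t u : padd (cls t) (cls u) = cls (Add t u).
Proof. by apply/clsP/cong_add; exact: rep_cls. Qed.

Lemma pmul_cls t u : pmul (cls t) (cls u) = cls (Mul t u).
Proof. by apply/clsP/cong_mul; exact: rep_cls. Qed.

Lemma popp_cls t : popp (cls t) = cls (Mul (Cst (-1)) t).
Proof. by apply/clsP/cong_mul; [exact: cong_refl|exact: rep_cls]. Qed.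

Lemma pscale_cls a t : pscale a (cls t) = cls (Mul (Cst a) t).
Proof. by apply/clsP/cong_mul; [exact: cong_refl|exact: rep_cls]. Qed.

Let pE := (padd_cls, pmul_cls, popp_cls, pscale_cls).

Lemma paddA : associative padd.
Proof.
move=> x y z; rewrite -(repK x) -(repK y) -(repK z) !pE; apply/clsP.
exact: cong_addA.
Qed.

Lemma paddC : commutative padd.
Proof.
by move=> x y; rewrite -(repK x) -(repK y) !pE; apply/clsP; exact: cong_addC.
Qed.

Lemma padd0 : left_id pzero padd.
Proof. by move=> x; rewrite -(repK x) !pE; apply/clsP; exact: cong_add0. Qed.

Lemma paddN : left_inverse pzero popp padd.
Proof. by move=> x; rewrite -(repK x) !pE; apply/clsP; exact: cong_addN. Qed.

HB.instance Definition _ :=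
  GRing.isZmodule.Build palg paddA paddC padd0 paddN.

Lemma pmulA : associative pmul.
Proof.
move=> x y z; rewrite -(repK x) -(repK y) -(repK z) !pE; apply/clsP.
exact: cong_mulA.
Qed.

Lemma pmul1l : left_id pone pmul.
Proof. by move=> x; rewrite -(repK x) !pE; apply/clsP; exact: cong_mul1l. Qed.

Lemma pmul1r : right_id pone pmul.
Proof. by move=> x; rewrite -(repK x) !pE; apply/clsP; exact: cong_mul1r. Qed.

Lemma pmulDl : left_distributive pmul +%R.
Proof.
move=> x y z; rewrite -(repK x) -(repK y) -(repK z) /+%R /= !pE; apply/clsP.
exact: cong_mulDl.
Qed.

Lemma pmulDr : right_distributive pmul +%R.
Proof.
move=> x y z; rewrite -(repK x) -(repK y) -(repK z) /+%R /= !pE; apply/clsP.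
exact: cong_mulDr.
Qed.

HB.instance Definition _ := GRing.Zmodule_isPzRing.Build palg
  pmulA pmul1l pmul1r pmulDl pmulDr.

Lemma pscaleA a b x : pscale a (pscale b x) = pscale (a * b) x.
Proof.
rewrite -(repK x) !pE; apply/clsP/(cong_trans (cong_mulA _ _ _))/cong_mul.
  exact/cong_sym/cong_cstM.
exact: cong_refl.
Qed.

Lemma pscale1 : left_id 1 pscale.
Proof. by move=> x; rewrite -(repK x) !pE; apply/clsP; exact: cong_mul1l. Qed.

Lemma pscaleDr : right_distributive pscale +%R.
Proof.
move=> a x y; rewrite -(repK x) -(repK y) /+%R /= !pE; apply/clsP.
exact: cong_mulDr.
Qed.

Lemma pscaleDl x : {morph pscale^~ x : a b / a + b}.
Proof.
move=> a b; rewrite -(repK x) /= !pE [RHS]padd_cls; apply/clsP.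
apply: cong_trans (cong_mulDl _ _ _).
by apply: cong_mul; [exact: cong_cstD|exact: cong_refl].
Qed.

HB.instance Definition _ := GRing.Zmodule_isLmodule.Build k palg
  pscaleA pscale1 pscaleDr pscaleDl.

Lemma palg_scaleAl (a : k) (x y : palg) : a *: (x * y) = (a *: x) * y.
Proof.
change (pscale a (pmul x y) = pmul (pscale a x) y).
rewrite -(repK x) -(repK y) !pE; apply/clsP; exact: cong_mulA.
Qed.

Lemma palg_scaleAr (a : k) (x y : palg) : a *: (x * y) = x * (a *: y).
Proof.
change (pscale a (pmul x y) = pmul x (pscale a y)).
rewrite -(repK x) -(repK y) !pE; apply/clsP.
apply: cong_trans (cong_mulA _ _ _) _.
apply: cong_trans (cong_sym (cong_mulA _ _ _)).
by apply: cong_mul; [exact: cong_cstC|exact: cong_refl].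
Qed.

Lemma cls_add t u : cls (Add t u) = cls t + cls u.
Proof. by rewrite -padd_cls. Qed.

Lemma cls_mul t u : cls (Mul t u) = cls t * cls u.
Proof. by rewrite -pmul_cls. Qed.

Lemma cls_cst a : cls (Cst a) = a *: (1 : palg).
Proof.
change (cls (Cst a) = pscale a pone); rewrite pscale_cls.
by apply/clsP/cong_sym/cong_mul1r.
Qed.

Lemma cls_exp t n : cls (Exp t n) = cls t ^+ n.
Proof.
elim: n => [|n IHn] /=; first by rewrite cls_cst scale1r expr0.
by rewrite cls_mul IHn exprS.
Qed.

Lemma cls_rel t u : rel t u -> cls t = cls u.
Proof. by move=> tu; apply/clsP; exact: cong_rel. Qed.

Section Eval.
Variables (B : algType k) (f : X -> B).

Fixpoint eval (t : tm) : B :=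
  match t with
  | Gen x => f x
  | Cst a => a%:A
  | Add t u => eval t + eval u
  | Mul t u => eval t * eval u
  end.

Lemma eval_exp t n : eval (Exp t n) = eval t ^+ n.
Proof.
by elim: n => [|n IHn] /=; rewrite ?scale1r ?expr0 // IHn exprS.
Qed.

Hypothesis f_rel : forall t u, rel t u -> eval t = eval u.

Lemma eval_cong t u : cong t u -> eval t = eval u.
Proof.
elim=> {t u} /=.
- exact: f_rel.
- by [].
- by move=> t u _ ->.
- by move=> t u v _ -> _ ->.
- by move=> t t' u u' _ -> _ ->.
- by move=> t t' u u' _ -> _ ->.
- by move=> *; rewrite addrA.
- by move=> *; rewrite addrC.
- by move=> *; rewrite scale0r add0r.
- by move=> t; rewrite scaleN1r mulN1r addNr scale0r.
- by move=> *; rewrite mulrA.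
- by move=> *; rewrite scale1r mul1r.
- by move=> *; rewrite scale1r mulr1.
- by move=> *; rewrite mulrDl.
- by move=> *; rewrite mulrDr.
- by move=> *; rewrite scalerDl.
- by move=> *; rewrite -scalerAl mul1r scalerA.
- by move=> *; rewrite -scalerAl -scalerAr mul1r mulr1.
Qed.

Definition lift (x : palg) : B := eval (rep x).

Lemma lift_cls t : lift (cls t) = eval t.
Proof. exact/eval_cong/rep_cls. Qed.

End Eval.

End Presentation.

Section Scalars.
Variables (R : realType) (p : nat).
Local Notation C := R[i].

Definition q : C := Complex (cos (pi / p%:R)) (sin (pi / p%:R)).

Definition qint (n : nat) : C := (q ^+ n - q ^- n) / (q - q^-1).

Definition beta (s : nat) : C := (q ^+ s + q ^- s) / (q - q^-1) ^+ 2.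

(* The sign in an upper index +/- is the scalar eps, equal to 1 or -1. *)

Definition cpos (eps : C) (s i : nat) : C := eps * (qint i * qint (s - i)).

Definition cneg (eps : C) (s i : nat) : C :=
  - eps * (qint i * qint (p - s - i)).

Definition alpha (eps : C) (s n : nat) : C :=
  \prod_(p - s - n.-1 <= i < p - s) cneg eps s i.

Definition gamma (eps : C) (s : nat) : C :=
  (2 * p)%:R * (\prod_(1 <= m < p - s) cneg eps s m)
             * (\prod_(1 <= i < s) cpos eps s i).

Definition delta (eps : C) (s : nat) : C :=
  (2 * p)%:R * (\prod_(1 <= m < p - s) cneg eps s m)
    * (\sum_(1 <= j < s) \prod_(1 <= i < s | i != j) cpos eps s i)
  + (2 * p)%:R * (\prod_(1 <= i < s) cpos eps s i)
    * (\sum_(1 <= n < p - s) \prod_(1 <= i < p - s | i != n) cneg eps s i).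

End Scalars.

Inductive uq_gen := genE | genF | genK.

Section Relations.
Variables (R : realType) (p : nat).
Local Notation C := R[i].
Local Notation tm := (term C uq_gen).
Local Notation q := (q R p).

Let tE : tm := Gen genE.
Let tF : tm := Gen genF.
Let tK : tm := Gen genK.
(* K^-1 is K^(2p-1), because K^(2p) = 1. *)
Let tKinv : tm := Exp tK (2 * p - 1).
Let sub (t u : tm) : tm := Add t (Mul (Cst (-1)) u).

Inductive uq_rel : tm -> tm -> Prop :=
| uq_relE : uq_rel (Exp tE p) (Cst 0)
| uq_relF : uq_rel (Exp tF p) (Cst 0)
| uq_relK : uq_rel (Exp tK (2 * p)) (Cst 1)
| uq_relKE : uq_rel (Mul (Mul tK tE) tKinv) (Mul (Cst (q ^+ 2)) tE)
| uq_relKF : uq_rel (Mul (Mul tK tF) tKinv) (Mul (Cst (q ^- 2)) tF)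
| uq_relEF : uq_rel (sub (Mul tE tF) (Mul tF tE))
                    (Mul (Cst (q - q^-1)^-1) (sub tK tKinv)).

(* hp makes the algebra nontrivial, as algType requires. *)
Definition uqsl2 (hp : (2 <= p)%N) : Type := palg uq_rel.

Variable hp : (2 <= p)%N.
Local Notation U := (uqsl2 hp).

HB.instance Definition _ := GRing.PzRing.on U.
HB.instance Definition _ := GRing.Lmodule.on U.

Definition uqE : U := cls uq_rel tE.
Definition uqF : U := cls uq_rel tF.
Definition uqK : U := cls uq_rel tK.
Definition uqKinv : U := uqK ^+ (2 * p - 1).

Section UniversalProperty.
Variables (B : algType C) (e f c : B).
Hypotheses (eX : e ^+ p = 0) (fX : f ^+ p = 0) (cX : c ^+ (2 * p) = 1).
Hypothesis ce : c * e * c ^+ (2 * p - 1) = q ^+ 2 *: e.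
Hypothesis cf : c * f * c ^+ (2 * p - 1) = q ^- 2 *: f.
Hypothesis ef : e * f - f * e = (q - q^-1)^-1 *: (c - c ^+ (2 * p - 1)).

Definition uq_val (g : uq_gen) : B :=
  match g with genE => e | genF => f | genK => c end.

Lemma uq_val_rel t u : uq_rel t u -> eval uq_val t = eval uq_val u.
Proof.
case; rewrite /= ?eval_exp /= ?scale0r ?scale1r //.
- by rewrite -scalerAl mul1r.
- by rewrite -scalerAl mul1r.
- by rewrite scaleN1r mulN1r ef -scalerAl mul1r mulN1r.
Qed.

Definition uq_lift (x : U) : B := lift uq_val x.

Let uq_liftE t : uq_lift (cls uq_rel t) = eval uq_val t.
Proof. exact: (lift_cls uq_val_rel). Qed.

Lemma uq_lift_gen : [/\ uq_lift uqE = e, uq_lift uqF = f & uq_lift uqK = c].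
Proof. by split; exact: uq_liftE. Qed.

Lemma uq_liftD x y : uq_lift (x + y) = uq_lift x + uq_lift y.
Proof. by rewrite -(repK x) -(repK y) -cls_add !uq_liftE. Qed.

Lemma uq_liftM x y : uq_lift (x * y) = uq_lift x * uq_lift y.
Proof. by rewrite -(repK x) -(repK y) -cls_mul !uq_liftE. Qed.

Lemma uq_lift1 : uq_lift 1 = 1.
Proof. by rewrite uq_liftE /= scale1r. Qed.

Lemma uq_liftZ (a : C) x : uq_lift (a *: x) = a *: uq_lift x.
Proof.
have -> : a *: x = cls uq_rel (Mul (Cst a) (rep x)).
  by rewrite cls_mul cls_cst repK -palg_scaleAl mul1r.
by rewrite uq_liftE /= -scalerAl mul1r.
Qed.

End UniversalProperty.

Lemma uqsl2_nonzero : 1 != 0 :> U.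
Proof.
have p0 : (0 < p)%N by exact: ltnW.
pose l := @uq_lift C^o 0 0 1.
have l1 : l 1 = 1 by apply: uq_lift1;
  rewrite ?expr0n ?expr1n ?gtn_eqF // ?(mulr0, mul0r, scaler0, subrr).
have l0 : l 0 = 0.
  have -> : (0 : U) = 0 *: (1 : U) by rewrite scale0r.
  rewrite /l uq_liftZ ?scale0r //;
  by rewrite ?expr0n ?expr1n ?gtn_eqF // ?(mulr0, mul0r, scaler0, subrr).
by apply/eqP => e10; move: l1; rewrite e10 l0 => /esym/eqP; rewrite oner_eq0.
Qed.

HB.instance Definition _ :=
  GRing.PzSemiRing_isNonZero.Build U uqsl2_nonzero.
HB.instance Definition _ := GRing.Lmodule_isLalgebra.Build C U
  (@palg_scaleAl C uq_gen uq_rel).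
HB.instance Definition _ := GRing.Lalgebra_isAlgebra.Build C U
  (@palg_scaleAr C uq_gen uq_rel).

End Relations.

Section RestrictedQuantumGroup.
Variables (R : realType) (p : nat) (hp : (2 <= p)%N).
Local Notation C := R[i].
Local Notation U := (uqsl2 R hp).
Local Notation q := (q R p).
Local Notation E := (uqE R hp).
Local Notation F := (uqF R hp).
Local Notation K := (uqK R hp).
Local Notation Kinv := (uqKinv R hp).

Lemma uqsl2_relations :
  [/\ E ^+ p = 0, F ^+ p = 0 & K ^+ (2 * p) = 1] /\
  [/\ K * Kinv = 1, Kinv * K = 1, K * E * Kinv = q ^+ 2 *: E,
      K * F * Kinv = q ^- 2 *: F
    & E * F - F * E = (q - q^-1)^-1 *: (K - Kinv)].
Proof.
have rel t u :
    @uq_rel R p t u -> cls (@uq_rel R p) t = cls (@uq_rel R p) u.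
  exact: cls_rel.
have KX : K ^+ (2 * p) = 1.
  by have := rel _ _ (uq_relK R p); rewrite cls_exp cls_cst scale1r.
have p2 : (2 * p - 1).+1 = (2 * p)%N.
  by rewrite subn1 prednK // muln_gt0 /= ltnW.
split; split => //.
- by have := rel _ _ (uq_relE R p); rewrite cls_exp cls_cst scale0r.
- by have := rel _ _ (uq_relF R p); rewrite cls_exp cls_cst scale0r.
- by rewrite /uqKinv -exprS p2.
- by rewrite /uqKinv -exprSr p2.
- have := rel _ _ (uq_relKE R p).
  by rewrite !cls_mul cls_exp cls_cst -palg_scaleAl mul1r.
- have := rel _ _ (uq_relKF R p).
  by rewrite !cls_mul cls_exp cls_cst -palg_scaleAl mul1r.
- have := rel _ _ (uq_relEF R p).
  rewrite !(cls_add, cls_mul, cls_exp, cls_cst).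
  by rewrite -!palg_scaleAl !mul1r !scaleN1r.
Qed.

Definition v (eps : C) (s : nat) : U :=
  \sum_(0 <= l < 2 * p) (eps * q ^- s.-1) ^+ l *: K ^+ l.

Definition a0 (eps : C) (s : nat) : U :=
  E ^+ p.-1 * F ^+ p.-1 * v eps s.

Definition b0 (eps : C) (s : nat) : U :=
  \sum_(1 <= n < (p - s).+1)
    alpha p eps s n *: (E ^+ (p - 1 - n) * F ^+ (p - 1 - n) * v eps s).

(* e_s^+ is e 1 s and e_s^- is e (-1) s, for 1 <= s <= p. *)
Definition e (eps : C) (s : nat) : U :=
  if s == p then
    ((2 * p)%:R * \prod_(1 <= i < p) cpos p eps p i)^-1 *: a0 eps p
  else
    (gamma p eps s)^-1 *:
      (b0 eps s - (delta p eps s / gamma p eps s) *: a0 eps s).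

Definition casimir : U :=
  E * F + ((q - q^-1) ^+ 2)^-1 *: (q^-1 *: K + q *: Kinv).

(* Generalized eigenspace of (multiplication by) the Casimir element. *)
Definition Q (s : nat) : set U :=
  [set x | exists n, (casimir - (beta R p s)%:A) ^+ n * x = 0].

Definition basic_idem (s : nat) : U :=
  if s == 0%N then e (-1) p
  else if s == p then e 1 p
  else e 1 s + e (-1) (p - s).

Definition B (s : nat) : set U :=
  [set basic_idem s * x * basic_idem s | x in Q s].

Lemma B_linear s (a : C) x y : B s x -> B s y -> B s (a *: x + y).
Proof.
move=> [x' [m xm] <-] [y' [n yn] <-]; exists (a *: x' + y'); last first.
  by rewrite mulrDr mulrDl -scalerAr -scalerAl.
exists (m + n)%N; rewrite mulrDr -scalerAr {1}addnC !exprD -!mulrA.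
by rewrite xm yn !mulr0 scaler0 addr0.
Qed.

Lemma B_mul s x y : B s x -> B s y -> B s (x * y).
Proof.
move=> [x' [m xm] <-] [y' _ <-].
exists (x' * basic_idem s * (basic_idem s * y')); last by rewrite !mulrA.
by exists m; rewrite !mulrA xm !mul0r.
Qed.

End RestrictedQuantumGroup.

Arguments casimir R {p} hp.
Arguments v R {p} hp eps s.
Arguments a0 R {p} hp eps s.
Arguments b0 R {p} hp eps s.
Arguments e R {p} hp eps s.
Arguments Q R {p} hp s _.
Arguments basic_idem R {p} hp s.
Arguments B R {p} hp s _.

Section SymmetricLinearFunctions.
Variables (k : fieldType) (A : algType k) (S : set A).

(* Only the values of phi on S matter: phi stands for its restriction to S,  *)
(* which is meant to be a linear subspace of A closed under products (see    *)
(* B_linear and B_mul).                                                      *)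
Definition is_slf (phi : A -> k) : Prop :=
  (forall (a : k) (x y : A), S x -> S y -> phi (a *: x + y) = a * phi x + phi y)
  /\ (forall x y : A, S x -> S y -> phi (x * y) = phi (y * x)).

(* phi is a basis of the space of symmetric linear functions of S; uniqueness *)
(* of the coordinates, e.g. of those of 0, is linear independence.           *)
Definition slf_dim (n : nat) : Prop :=
  exists phi : 'I_n -> A -> k,
    (forall i, is_slf (phi i)) /\
    (forall psi, is_slf psi ->
       exists! c : 'rV[k]_n,
         forall x, S x -> psi x = \sum_(i < n) c 0 i * phi i x).

End SymmetricLinearFunctions.

(* Main.v *)
Require Import Defs.
From HB Require Import structures.
From mathcomp Require Import all_boot all_order all_algebra.
From mathcomp Require Import boolp classical_sets reals trigo.
From mathcomp Require Import complex.
From mathcomp Require Import ring lra zify.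

(* Write [f = f1 + f2] for the idempotent defining B_s (1 <= s <= p - 1), [c]
   for the Casimir element and [y = c - beta_s].  Each [f_i] is a polynomial in
   [c] times a weight projection [V], and [y^2 f_i = 0]; as this polynomial does
   not vanish at [beta_s], B_s = f U f.

   Upper bound.  Since V U V is spanned by the [c^n V], the diagonal corners of
   B_s are spanned by [f_i] and [y f_i].  A symmetric linear function vanishes
   on the off-diagonal corners, and its values on [y f1] and [y f2] determine
   each other: these are, up to nonzero scalars, [Y X] and [X Y] for
   [X = f2 F^s f1] and [Y = f1 E^s f2].

   Lower bound.  Let A be generated over the complex numbers by commuting [a]
   and [b] with [a^2 = b^2 = 0].  Then U acts on A^p by weighted cyclic shifts
   with [c = beta_s + a b].  The coefficient of [a b] in the trace does not
   vanish on [y f1].  At [a = b = 0] this representation is block diagonal, and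
   the traces of its two blocks separate [f1] from [f2].

   For s = 0 and s = p there is only one weight and [y f = 0], so that B_s is
   one-dimensional. *)

Set Implicit Arguments.
Unset Strict Implicit.
Unset Printing Implicit Defensive.

Import Order.TTheory GRing.Theory Num.Theory.
Local Open Scope ring_scope.

(** * Weight spaces and the Casimir element *)

Section RootOfUnity.
Variables (k : fieldType) (p : nat) (q : k).
Hypotheses (p_gt1 : (1 < p)%N) (q_prim : (2 * p).-primitive_root q).

(* [E F] acts on the weight space of weight [w] as [cas - casval w]. *)
Definition casval (w : k) : k := (q^-1 * w + q * w^-1) / (q - q^-1) ^+ 2.

Lemma q_neq0 : q != 0.
Proof.
apply/eqP => q0; move: (prim_expr_order q_prim).
rewrite q0 expr0n muln_eq0 /= gtn_eqF ?(ltnW p_gt1) // => /eqP.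
by rewrite eq_sym oner_eq0.
Qed.

Lemma q2_eq1 n : (q ^+ (2 * n) == 1) = (p %| n)%N.
Proof. by rewrite -(prim_order_dvd q_prim) dvdn_pmul2l. Qed.

Lemma qq_neq1 : q * q - 1 != 0.
Proof.
by rewrite subr_eq0 -expr2 -[2%N]muln1 q2_eq1 dvdn1 gtn_eqF.
Qed.

Lemma q_subV_neq0 : q - q^-1 != 0.
Proof.
apply: contraNneq qq_neq1 => h.
by rewrite -(mulfV q_neq0) -mulrBr h mulr0.
Qed.

(** Up to a constant factor [casval w] is [q^-1 w] plus its inverse, so its fibres are the orbits of
    [w -> q^2 / w]. *)
Lemma casval_eq a b : a != 0 -> b != 0 ->
  (casval a == casval b) = (a == b) || (a * b == q ^+ 2).
Proof.
move=> a0 b0; rewrite -subr_eq0.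
have -> : casval a - casval b
    = (a - b) * (a * b - q ^+ 2) / (q * (a * b) * (q - q^-1) ^+ 2).
  by rewrite /casval; field; rewrite q_neq0 a0 b0 qq_neq1.
rewrite !mulf_eq0 invr_eq0 !mulf_eq0 !(negPf q_neq0, negPf a0, negPf b0).
by rewrite (negPf q_subV_neq0) !orbF !subr_eq0.
Qed.

(** [casval (w * q ^+ 2)] is the Casimir value of a highest weight vector of weight [w]. With this
    value, [E F] vanishes on the chain of weights [w / q ^+ (2 * j)] at the last of the first [s]
    weights and where the chain closes up cyclically; for [s = p] these two places coincide. *)
Lemma casval_highest_eq s w j : w != 0 -> w ^+ 2 = q ^+ (2 * s.-1) ->
  (0 < s <= p)%N -> (j < p)%N ->
  (casval (w * q ^+ 2) == casval (w / q ^+ (2 * j)))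
  = (j == s.-1) || (j == p.-1).
Proof.
move=> w0 w2 /andP[s0 sp] jp.
have qn n : q ^+ n != 0 by rewrite expf_neq0 // q_neq0.
rewrite casval_eq; [|exact: mulf_neq0|by rewrite mulf_neq0 ?invr_neq0].
rewrite orbC; congr (_ || _).
  have -> : w * q ^+ 2 * (w / q ^+ (2 * j)) = q ^+ 2 * (w ^+ 2 / q ^+ (2 * j)).
    by rewrite mulrACA -expr2 mulrCA.
  rewrite -[X in _ == X]mulr1 (inj_eq (mulfI (qn _))) w2.
  rewrite -(inj_eq (mulIf (qn (2 * j)%N))) divfK // mul1r.
  rewrite (eq_prim_root_expr q_prim) -!muln_modr eqn_pmul2l // !modn_small //.
  by rewrite prednK.
rewrite (inj_eq (mulfI w0)) -(inj_eq (mulIf (qn (2 * j)%N))) mulVf //.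
rewrite -exprD -mulnS q2_eq1; apply/idP/eqP => [|->].
  move=> /dvdn_leq; rewrite ltnS => /(_ isT) pj.
  by apply/eqP; rewrite -eqSS prednK ?(ltnW p_gt1) // eqn_leq pj jp.
by rewrite prednK ?(ltnW p_gt1).
Qed.

End RootOfUnity.

Section WeightCalculus.
Variables (k : numFieldType) (p : nat) (q : k).
Hypotheses (p_gt1 : (1 < p)%N) (q_prim : (2 * p).-primitive_root q).
Variables (U : algType k) (E F K Ki : U).
Hypotheses (EX : E ^+ p = 0) (FX : F ^+ p = 0) (KX : K ^+ (2 * p) = 1).
Hypotheses (KKi : K * Ki = 1) (KiK : Ki * K = 1).
Hypotheses (KE : K * E = q ^+ 2 *: (E * K)) (KF : K * F = q ^- 2 *: (F * K)).
Hypothesis EF : E * F - F * E = (q - q^-1)^-1 *: (K - Ki).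
Hypothesis U_ind : forall S : U -> Prop, S E -> S F -> S K ->
  (forall a, S (a%:A)) -> (forall x y, S x -> S y -> S (x + y)) ->
  (forall x y, S x -> S y -> S (x * y)) -> forall x, S x.

Definition cas : U :=
  E * F + ((q - q^-1) ^+ 2)^-1 *: (q^-1 *: K + q *: Ki).

(** For a [2p]-th root of unity [w] this is [2p] times the projection onto the [w]-eigenspace of
    [K]. It is left unnormalised to match [v], whence the factors [(2 * p)%:R] below. *)
Definition wt (w : k) : U := \sum_(0 <= l < 2 * p) w^-1 ^+ l *: K ^+ l.

Local Notation casval := (casval q).

Let p_gt0 : (0 < p)%N. Proof. exact: ltnW. Qed.
Let q0 : q != 0. Proof. exact: q_neq0 q_prim. Qed.
Let qn0 n : q ^+ n != 0. Proof. by rewrite expf_neq0. Qed.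
Let qq1 : q * q - 1 != 0. Proof. exact: qq_neq1 q_prim. Qed.

Lemma EK : E * K = q ^- 2 *: (K * E).
Proof. by rewrite KE scalerA mulVf ?scale1r. Qed.

Lemma FK : F * K = q ^+ 2 *: (K * F).
Proof. by rewrite KF scalerA mulfV ?scale1r. Qed.

Lemma KiE : Ki * E = q ^- 2 *: (E * Ki).
Proof.
rewrite -[E in LHS]mulr1 -KKi (mulrA E) EK -scalerAl -scalerAr.
by rewrite -!mulrA (mulrA Ki) KiK mul1r.
Qed.

Lemma KiF : Ki * F = q ^+ 2 *: (F * Ki).
Proof.
rewrite -[F in LHS]mulr1 -KKi (mulrA F) FK -scalerAl -scalerAr.
by rewrite -!mulrA (mulrA Ki) KiK mul1r.
Qed.

Lemma FE : F * E = E * F - (q - q^-1)^-1 *: (K - Ki).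
Proof. by rewrite -EF opprB addrC subrK. Qed.

Lemma cas_FE : cas = F * E + ((q - q^-1) ^+ 2)^-1 *: (q *: K + q^-1 *: Ki).
Proof.
rewrite FE /cas -addrA; congr (_ + _).
rewrite !scalerDr !scalerN !scalerA opprD opprK addrACA -scaleNr -!scalerDl.
by congr (_ *: _ + _ *: _); field; rewrite ?q0.
Qed.

(** With [cas] in its [E F] form on the left and its [F E] form on the right, both leading terms are
    [E F E]. *)
Lemma cas_commE : GRing.comm cas E.
Proof.
rewrite /GRing.comm {1}/cas cas_FE mulrDl mulrDr -!mulrA; congr (_ + _).
rewrite -!scalerAl -!scalerAr !mulrDl !mulrDr -!scalerAl -!scalerAr KE KiE.
by rewrite !scalerA; congr (_ *: (_ *: _ + _ *: _)); field; rewrite ?q0.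
Qed.

Lemma cas_commF : GRing.comm cas F.
Proof.
rewrite /GRing.comm {1}cas_FE /cas mulrDl mulrDr -!mulrA; congr (_ + _).
rewrite -!scalerAl -!scalerAr !mulrDl !mulrDr -!scalerAl -!scalerAr KF KiF.
by rewrite !scalerA; congr (_ *: (_ *: _ + _ *: _)); field; rewrite ?q0.
Qed.

Lemma cas_commK : GRing.comm cas K.
Proof.
rewrite /GRing.comm /cas mulrDl mulrDr; congr (_ + _).
  rewrite -(mulrA E) FK -scalerAr (mulrA E) EK -scalerAl scalerA mulfV //.
  by rewrite scale1r mulrA.
by rewrite -!scalerAl -!scalerAr !mulrDl !mulrDr -!scalerAl -!scalerAr KKi KiK.
Qed.

Lemma cas_comm x : GRing.comm cas x.
Proof.
elim/U_ind: x => [||||x y|x y].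
- exact: cas_commE.
- exact: cas_commF.
- exact: cas_commK.
- by move=> a; rewrite /GRing.comm -scalerAl -scalerAr mul1r mulr1.
- exact: commrD.
- exact: commrM.
Qed.

Local Notation ev := (horner_alg cas).

Lemma ev_comm P x : GRing.comm (ev P) x.
Proof.
elim/poly_ind: P => [|P c IH]; first by rewrite rmorph0; apply/commr_sym/commr0.
apply/commr_sym; rewrite rmorphD rmorphM /= horner_algX horner_algC.
apply: commrD; first by apply: commrM; apply/commr_sym => //; exact: cas_comm.
by rewrite /GRing.comm -scalerAl -scalerAr mul1r mulr1.
Qed.

Lemma ev_mulCA P x y : x * (ev P * y) = ev P * (x * y).
Proof. by rewrite mulrA -ev_comm mulrA. Qed.

Lemma ev_sandwich P P' a x y b :
  a * (ev P * x) * (ev P' * y * b) = ev (P * P') * (a * x * y * b).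
Proof.
by rewrite ev_mulCA -(mulrA (ev P') y) ev_mulCA !mulrA -rmorphM mulrC.
Qed.

Lemma evZ a P : ev (a *: P) = a *: ev P.
Proof. by rewrite linearZ /= mulr_algl. Qed.

Lemma K_wt w : w ^+ (2 * p) = 1 -> K * wt w = w *: wt w.
Proof.
move=> w1; have w0 : w != 0.
  apply/eqP => w0; move/eqP: w1; rewrite w0 expr0n muln_eq0 /= gtn_eqF //.
  by rewrite eq_sym oner_eq0.
pose z := w^-1 *: K.
have wtE : wt w = \sum_(i < 2 * p) z ^+ i.
  by rewrite /wt big_mkord; apply: eq_bigr => i _; rewrite exprZn.
(* [wt w] is a geometric sum in [z], and [z ^+ (2 * p) = 1]. *)
have : (z - 1) * wt w = 0.
  by rewrite wtE -subrX1 exprZn KX exprVn w1 invr1 scale1r subrr.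
rewrite mulrBl mul1r => /eqP; rewrite subr_eq0 => /eqP {2}<-.
by rewrite -scalerAl scalerA mulfV // scale1r.
Qed.

Lemma wt_commK w : GRing.comm (wt w) K.
Proof.
apply/commr_sym/commr_sum => l _; rewrite /GRing.comm -scalerAl -scalerAr.
by rewrite -exprS -exprSr.
Qed.

Lemma KXE l : K ^+ l * E = q ^+ (2 * l) *: (E * K ^+ l).
Proof.
elim: l => [|l IH]; first by rewrite muln0 !expr0 mul1r mulr1 scale1r.
rewrite exprS -(mulrA K) IH -scalerAr (mulrA K E) KE -scalerAl -mulrA scalerA.
by rewrite -exprD mulnS addnC.
Qed.

Lemma KXF l : K ^+ l * F = q ^- (2 * l) *: (F * K ^+ l).
Proof.
elim: l => [|l IH].
  by rewrite muln0 !expr0 mul1r mulr1 invr1 scale1r.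
rewrite exprS -(mulrA K) IH -scalerAr (mulrA K F) KF -scalerAl -mulrA scalerA.
by rewrite -invfM -exprD mulnSr.
Qed.

Lemma wtE w : wt w * E = E * wt (w / q ^+ 2).
Proof.
rewrite /wt mulr_suml mulr_sumr; apply: eq_bigr => l _.
rewrite -scalerAl KXE -scalerAr scalerA; congr (_ *: _).
by rewrite invfM invrK exprMn exprM.
Qed.

Lemma wtF w : wt w * F = F * wt (w * q ^+ 2).
Proof.
rewrite /wt mulr_suml mulr_sumr; apply: eq_bigr => l _.
rewrite -scalerAl KXF -scalerAr scalerA; congr (_ *: _).
by rewrite invfM exprMn exprM [(q ^+ 2)^-1 ^+ l]exprVn.
Qed.

Lemma wtEX n w : wt w * E ^+ n = E ^+ n * wt (w / q ^+ (2 * n)).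
Proof.
elim: n w => [|n IH] w; first by rewrite muln0 expr0 divr1 mulr1 mul1r.
rewrite exprS mulrA wtE -mulrA IH mulrA; congr (_ * wt _).
by rewrite -mulrA -invfM -exprD -mulnS.
Qed.

Lemma wtFX n w : wt w * F ^+ n = F ^+ n * wt (w * q ^+ (2 * n)).
Proof.
elim: n w => [|n IH] w; first by rewrite muln0 expr0 !mulr1 mul1r.
rewrite exprS mulrA wtF -mulrA IH mulrA; congr (_ * wt _).
by rewrite -mulrA -exprD -mulnS.
Qed.

Lemma EX_wt n w : E ^+ n * wt w = wt (w * q ^+ (2 * n)) * E ^+ n.
Proof. by rewrite wtEX mulfK. Qed.

Lemma FX_wt n w : F ^+ n * wt w = wt (w / q ^+ (2 * n)) * F ^+ n.
Proof. by rewrite wtFX divfK. Qed.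

Lemma wtM0 w w' : w ^+ (2 * p) = 1 -> w' ^+ (2 * p) = 1 -> w != w' ->
  wt w * wt w' = 0.
Proof.
move=> w1 w'1 ww'; have : (w - w') *: (wt w * wt w') = 0.
  rewrite scalerBl scalerAl -K_wt // -wt_commK -mulrA K_wt // -scalerAr.
  by rewrite subrr.
by move/eqP; rewrite scaler_eq0 subr_eq0 (negPf ww') => /eqP.
Qed.

Lemma KX_wt l w : w ^+ (2 * p) = 1 -> K ^+ l * wt w = w ^+ l *: wt w.
Proof.
move=> w1; elim: l => [|l IH]; first by rewrite mul1r scale1r.
by rewrite exprS -mulrA IH -scalerAr K_wt // scalerA exprSr.
Qed.

Lemma wt_neq0 (w : k) : w ^+ (2 * p) = 1 -> w != 0.
Proof.
move=> w1; apply/eqP => w0; move/eqP: w1.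
by rewrite w0 expr0n muln_eq0 /= gtn_eqF // eq_sym oner_eq0.
Qed.

Lemma wtM w : w ^+ (2 * p) = 1 -> wt w * wt w = (2 * p)%:R *: wt w.
Proof.
move=> w1; rewrite {1}/wt mulr_suml.
rewrite (eq_bigr (fun=> wt w)); last first.
  move=> l _; rewrite -scalerAl KX_wt // scalerA exprVn mulVf ?scale1r //.
  by rewrite expf_neq0 // wt_neq0.
by rewrite sumr_const_nat subn0 scaler_nat.
Qed.

Lemma Ki_wt w : w ^+ (2 * p) = 1 -> Ki * wt w = w^-1 *: wt w.
Proof.
move=> w1; rewrite -[wt w in RHS]mul1r -KiK -mulrA K_wt // -scalerAr scalerA.
by rewrite mulVf ?scale1r // wt_neq0.
Qed.

Lemma EF_wt w : w ^+ (2 * p) = 1 ->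
  E * F * wt w = ev ('X - (casval w)%:P) * wt w.
Proof.
move=> w1; rewrite rmorphB /= horner_algX horner_algC mulrBl -scalerAl mul1r.
rewrite /cas mulrDl -!scalerAl mulrDl -!scalerAl K_wt // Ki_wt //.
by rewrite !scalerA -scalerDl scalerA mulrC addrK.
Qed.

Lemma FE_wt w : w ^+ (2 * p) = 1 ->
  F * E * wt w = ev ('X - (casval (w * q ^+ 2))%:P) * wt w.
Proof.
move=> w1; rewrite rmorphB /= horner_algX horner_algC mulrBl -scalerAl mul1r.
rewrite cas_FE mulrDl -!scalerAl mulrDl -!scalerAl K_wt // Ki_wt //.
rewrite !scalerA -scalerDl scalerA.
suff -> : casval (w * q ^+ 2) = ((q - q^-1) ^+ 2)^-1 * (q * w + q^-1 * w^-1).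
  by rewrite addrK.
by rewrite /casval; field; rewrite q0 qq1 wt_neq0.
Qed.

Lemma wt_shift n (w : k) :
  w ^+ (2 * p) = 1 -> (w * q ^+ (2 * n)) ^+ (2 * p) = 1.
Proof.
move=> w1; rewrite exprMn w1 mul1r -exprM mulnC exprM.
by rewrite (prim_expr_order q_prim) expr1n.
Qed.

Lemma wt_shiftV n (w : k) :
  w ^+ (2 * p) = 1 -> (w / q ^+ (2 * n)) ^+ (2 * p) = 1.
Proof.
move=> w1; rewrite exprMn w1 mul1r exprVn -exprM mulnC exprM.
by rewrite (prim_expr_order q_prim) expr1n invr1.
Qed.

(** The innermost [E F] acts on the weight space reached by [F ^+ n], where it is linear in the
    central [cas]; peeling it off yields one factor per step. *)
Lemma EFX_wt n w : w ^+ (2 * p) = 1 ->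
  E ^+ n * F ^+ n * wt w
  = ev (\prod_(0 <= j < n) ('X - (casval (w / q ^+ (2 * j)))%:P)) * wt w.
Proof.
move=> w1; elim: n => [|n IH].
  by rewrite big_geq // rmorph1 !expr0 !mul1r.
rewrite big_nat_recr //= mulrC rmorphM (exprSr E) (exprS F).
transitivity (E ^+ n * (E * F * wt (w / q ^+ (2 * n))) * F ^+ n).
  by rewrite -!mulrA (FX_wt n w).
rewrite EF_wt ?wt_shiftV // (mulrA (E ^+ n)) -ev_comm -!mulrA -(FX_wt n w).
by rewrite (mulrA (E ^+ n)) IH.
Qed.

Lemma FEX_wt n w : w ^+ (2 * p) = 1 ->
  F ^+ n * E ^+ n * wt w
  = ev (\prod_(0 <= j < n) ('X - (casval (w * q ^+ (2 * j.+1)))%:P)) * wt w.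
Proof.
move=> w1; elim: n => [|n IH].
  by rewrite big_geq // rmorph1 !expr0 !mul1r.
rewrite big_nat_recr //= mulrC rmorphM (exprSr F) (exprS E).
transitivity (F ^+ n * (F * E * wt (w * q ^+ (2 * n))) * E ^+ n).
  by rewrite -!mulrA (EX_wt n w).
rewrite FE_wt ?wt_shift // (mulrA (F ^+ n)) -ev_comm -!mulrA -(EX_wt n w).
by rewrite (mulrA (F ^+ n)) IH -exprD -mulnSr.
Qed.

(** A normal form for the left ideal generated by [wt w]: no spanning element mixes [E] and [F],
    because [E F] and [F E] act on weight spaces as polynomials in [cas]. *)
Inductive wt_span (w : k) : U -> Prop :=
| wt_spanF n P : wt_span w (F ^+ n * ev P * wt w)
| wt_spanE n P : wt_span w (E ^+ n * ev P * wt w)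
| wt_spanD x y : wt_span w x -> wt_span w y -> wt_span w (x + y).

Lemma E_FX_wt n P w : w ^+ (2 * p) = 1 ->
  E * (F ^+ n.+1 * ev P * wt w)
  = F ^+ n * ev (P * ('X - (casval (w / q ^+ (2 * n)))%:P)) * wt w.
Proof.
move=> w1; transitivity (ev P * (E * F * wt (w / q ^+ (2 * n))) * F ^+ n).
  rewrite -[F ^+ n.+1 * _]ev_comm exprS !mulrA -(ev_comm P E) -!mulrA.
  by rewrite (FX_wt n w).
rewrite EF_wt ?wt_shiftV // (mulrA (ev P)) -rmorphM -mulrA -FX_wt mulrA.
by rewrite ev_comm.
Qed.

Lemma F_EX_wt n P w : w ^+ (2 * p) = 1 ->
  F * (E ^+ n.+1 * ev P * wt w)
  = E ^+ n * ev (P * ('X - (casval (w * q ^+ (2 * n.+1)))%:P)) * wt w.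
Proof.
move=> w1; transitivity (ev P * (F * E * wt (w * q ^+ (2 * n))) * E ^+ n).
  rewrite -[E ^+ n.+1 * _]ev_comm exprS !mulrA -(ev_comm P F) -!mulrA.
  by rewrite (EX_wt n w).
rewrite FE_wt ?wt_shift // (mulrA (ev P)) -rmorphM -mulrA -EX_wt mulrA.
by rewrite ev_comm -(mulrA w) -exprD -mulnSr.
Qed.

(** A generator of the opposite kind lowers the power by one at the cost of a linear factor in
    [cas]; at power zero it switches to the other family. *)
Lemma wt_spanM w x y : w ^+ (2 * p) = 1 -> wt_span w y -> wt_span w (x * y).
Proof.
move=> w1; elim/U_ind: x y => [|||a|x y IHx IHy|x y IHx IHy] z.
- elim=> [[|n] P|n P|? ? ? ? ? ?]; last by rewrite mulrDr; exact: wt_spanD.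
  + by rewrite expr0 mul1r mulrA; exact: (wt_spanE _ 1).
  + by rewrite E_FX_wt //; exact: wt_spanF.
  + by rewrite !mulrA -exprS; exact: wt_spanE.
- elim=> [n P|[|n] P|? ? ? ? ? ?]; last by rewrite mulrDr; exact: wt_spanD.
  + by rewrite !mulrA -exprS; exact: wt_spanF.
  + by rewrite expr0 mul1r mulrA; exact: (wt_spanF _ 1).
  + by rewrite F_EX_wt //; exact: wt_spanE.
- elim=> [n P|n P|? ? ? ? ? ?]; last by rewrite mulrDr; exact: wt_spanD.
  + have -> : K * (F ^+ n * ev P * wt w)
        = F ^+ n * ev ((w / q ^+ (2 * n)) *: P) * wt w.
      rewrite evZ -scalerAr -!scalerAl -ev_comm -!mulrA FX_wt.
      rewrite (mulrA K) -ev_comm -mulrA (mulrA K) K_wt ?wt_shiftV //.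
      by rewrite -scalerAl -scalerAr.
    exact: wt_spanF.
  + have -> : K * (E ^+ n * ev P * wt w)
        = E ^+ n * ev ((w * q ^+ (2 * n)) *: P) * wt w.
      rewrite evZ -scalerAr -!scalerAl -ev_comm -!mulrA EX_wt.
      rewrite (mulrA K) -ev_comm -mulrA (mulrA K) K_wt ?wt_shift //.
      by rewrite -scalerAl -scalerAr.
    exact: wt_spanE.
- elim=> [n P|n P|? ? ? ? ? ?]; last by rewrite mulrDr; exact: wt_spanD.
  + rewrite -scalerAl mul1r scalerAl scalerAr -evZ; exact: wt_spanF.
  + rewrite -scalerAl mul1r scalerAl scalerAr -evZ; exact: wt_spanE.
- by move=> sz; rewrite mulrDl; apply: wt_spanD; [exact: IHx|exact: IHy].
- by move=> sz; rewrite -mulrA; apply: IHx; exact: IHy.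
Qed.

(* Of the spanning elements only multiples of [wt w] itself have weight [w]: *)
(* [F ^+ n] and [E ^+ n] shift it by [q ^+ (2 * n)], and vanish for [n >= p]. *)
Lemma wt_corner w x : w ^+ (2 * p) = 1 ->
  exists P, wt w * x * wt w = ev P * wt w.
Proof.
move=> w1; have : wt_span w (x * wt w).
  apply: wt_spanM => //; have := wt_spanF w 0 1.
  by rewrite expr0 mul1r rmorph1 mul1r.
rewrite -mulrA; elim: (x * wt w) / => [n P|n P|y z _ [P Py] _ [P' Pz]].
- case: n => [|n].
    exists ((2 * p)%:R *: P); rewrite expr0 mul1r mulrA -ev_comm -mulrA wtM //.
    by rewrite -scalerAr evZ -scalerAl.
  exists 0; rewrite rmorph0 mul0r; case: (leqP p n.+1) => pn.
    by rewrite -(subnK pn) exprD FX !(mulr0, mul0r).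
  rewrite -mulrA ev_comm !mulrA wtFX -(mulrA (F ^+ n.+1)) wtM0 ?wt_shift //.
    by rewrite mulr0 mul0r.
  rewrite -{2}[w]mulr1 (inj_eq (mulfI (wt_neq0 w1))) (q2_eq1 q_prim).
  by rewrite gtnNdvd.
- case: n => [|n].
    exists ((2 * p)%:R *: P); rewrite expr0 mul1r mulrA -ev_comm -mulrA wtM //.
    by rewrite -scalerAr evZ -scalerAl.
  exists 0; rewrite rmorph0 mul0r; case: (leqP p n.+1) => pn.
    by rewrite -(subnK pn) exprD EX !(mulr0, mul0r).
  rewrite -mulrA ev_comm !mulrA wtEX -(mulrA (E ^+ n.+1)) wtM0 ?wt_shiftV //.
    by rewrite mulr0 mul0r.
  rewrite -{2}[w]mulr1 (inj_eq (mulfI (wt_neq0 w1))) invr_eq1.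
  by rewrite (q2_eq1 q_prim) gtnNdvd.
- by exists (P + P'); rewrite mulrDr Py Pz rmorphD mulrDl.
Qed.

(** * Elements killed by a power of [cas - c] *)

Definition killed c n x := ev (('X - c%:P) ^+ n) * x = 0.

Lemma killed_ev1 c x P : killed c 1 x -> ev P * x = P.[c] *: x.
Proof.
move=> x1; have : root (P - P.[c]%:P) c by rewrite rootE !hornerE subrr.
case/factor_theorem => P1 /eqP; rewrite subr_eq => /eqP ->.
rewrite hornerD hornerM hornerXsubC subrr mulr0 add0r hornerC.
rewrite rmorphD rmorphM /= horner_algC mulrDl -mulrA mulr_algl.
by rewrite -['X - _]expr1 x1 mulr0 add0r.
Qed.

(** Taylor expansion of [P] at [c] to first order. *)
Lemma killed_ev2 c x P : killed c 2 x ->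
  exists d, ev P * x = P.[c] *: x + d *: (ev ('X - c%:P) * x).
Proof.
move=> x2; have rootB (R : {poly k}) : root (R - R.[c]%:P) c.
  by rewrite rootE !hornerE subrr.
have [P1 /eqP] := factor_theorem _ _ (rootB P); rewrite subr_eq => /eqP PE.
have [P2 /eqP] := factor_theorem _ _ (rootB P1); rewrite subr_eq => /eqP P1E.
exists P1.[c]; pose D := 'X - c%:P; rewrite -/D.
have -> : ev P = ev P2 * ev (D ^+ 2) + P1.[c] *: ev D + P.[c]%:A.
  rewrite {1}PE {1}P1E mulrDl -mulrA -expr2 rmorphD rmorphD /=.
  rewrite (rmorphM _ P2) (rmorphM _ P1.[c]%:P) /= !horner_algC.
  by rewrite mulr_algl.
by rewrite !mulrDl -mulrA x2 mulr0 add0r addrC -!scalerAl mul1r.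
Qed.

Lemma killed_evM c x G : killed c 2 x ->
  ev (G * ('X - c%:P)) * x = G.[c] *: (ev ('X - c%:P) * x).
Proof.
move=> x2; rewrite rmorphM -mulrA.
have y2 : ev ('X - c%:P) * (ev ('X - c%:P) * x) = 0.
  by rewrite mulrA -rmorphM -expr2.
have [|d ->] := @killed_ev2 c (ev ('X - c%:P) * x) G.
  by rewrite /killed mulrA -rmorphM -exprSr exprS rmorphM -mulrA x2 mulr0.
by rewrite y2 scaler0 addr0.
Qed.

(** As [h] is coprime to [('X - c%:P) ^+ n], a Bezout coefficient inverts [ev h] on [x]. *)
Lemma killed_inv c n x h : h.[c] != 0 -> killed c n x ->
  exists v, ev v * (ev h * x) = x.
Proof.
move=> hc xn; have : coprimep (('X - c%:P) ^+ n) h.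
  by apply: coprimep_expl; rewrite coprimep_sym coprimep_XsubC.
move=> /Bezout_eq1_coprimepP[[u v] /= uv]; exists v.
rewrite -[RHS]mul1r -(rmorph1 ev) -uv rmorphD !rmorphM mulrDl -!mulrA xn.
by rewrite mulr0 add0r.
Qed.

Lemma ev_wtM0 P P' w w' : w ^+ (2 * p) = 1 -> w' ^+ (2 * p) = 1 -> w != w' ->
  ev P * wt w * (ev P' * wt w') = 0.
Proof.
move=> w1 w'1 ww'; rewrite (mulrA _ (ev P')) -(ev_comm P') -!mulrA.
by rewrite wtM0 // !mulr0.
Qed.

Lemma wt_evM P w : w ^+ (2 * p) = 1 ->
  wt w * (ev P * wt w) = (2 * p)%:R *: (ev P * wt w).
Proof. by move=> w1; rewrite mulrA -ev_comm -mulrA wtM // scalerAr. Qed.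

Lemma ev_wtM P P' w x : w ^+ (2 * p) = 1 ->
  ev P * wt w * (ev P' * wt w * x) = (2 * p)%:R *: (ev P' * (ev P * wt w * x)).
Proof.
move=> w1; rewrite -(mulrA (ev P)) (mulrA (wt w)) wt_evM //.
rewrite -scalerAl -scalerAr; congr (_ *: _).
by rewrite !mulrA (ev_comm P).
Qed.

Let p2 : (2 * p)%:R != 0 :> k.
Proof. by rewrite pnatr_eq0 muln_eq0 /= gtn_eqF. Qed.

(** A substitute for idempotency: the square of [ev P * wt w] is [2p P(cas)] times the element
    itself, and that factor can be inverted by [killed_inv]. *)
Lemma ev_wt_self P c n w : w ^+ (2 * p) = 1 -> P.[c] != 0 ->
  killed c n (ev P * wt w) ->
  exists v, ev v * (ev P * wt w) * (ev P * wt w) = ev P * wt w.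
Proof.
move=> w1 Pc kP; have [|v vE] := @killed_inv c n _ ((2 * p)%:R *: P) _ kP.
  by rewrite hornerZ mulf_neq0.
exists v; rewrite -[RHS]vE -mulrA; congr (_ * _).
by rewrite -[X in _ * X = _]mulr1 ev_wtM // mulr1 evZ -scalerAl.
Qed.

Lemma ev_wt_corner P w x : w ^+ (2 * p) = 1 ->
  exists R, ev P * wt w * x * (ev P * wt w) = ev R * (ev P * wt w).
Proof.
move=> w1; have [R xE] := wt_corner x w1; exists (P * R).
transitivity (ev (P * P) * (wt w * x * wt w)).
  by rewrite (mulrA _ (ev P)) -(ev_comm P) rmorphM !mulrA.
by rewrite xE !mulrA -!rmorphM mulrAC.
Qed.

(** * The corner cut out by two weights *)

Section TwoWeights.
Variables (s : nat) (w : k) (h h' : {poly k}).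
Hypotheses (s_bounds : (0 < s < p)%N) (w1 : w ^+ (2 * p) = 1).
Hypothesis w2 : w ^+ 2 = q ^+ (2 * s.-1).
Let w' := w / q ^+ (2 * s).
Let c := casval (w * q ^+ 2).
Let f1 := ev h * wt w.
Let f2 := ev h' * wt w'.
Let f := f1 + f2.
Hypotheses (hc : h.[c] != 0) (h'c : h'.[c] != 0).
Hypotheses (f1k : killed c 2 f1) (f2k : killed c 2 f2).

Let w'1 : w' ^+ (2 * p) = 1. Proof. exact: wt_shiftV. Qed.

Let ww' : w != w'.
Proof.
rewrite -[w in X in X != _]mulr1 /w' (inj_eq (mulfI (wt_neq0 w1))) eq_sym.
by rewrite invr_eq1 (q2_eq1 q_prim) gtnNdvd; case/andP: s_bounds.
Qed.

Let f12 : f1 * f2 = 0. Proof. exact: ev_wtM0. Qed.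
Let f21 : f2 * f1 = 0. Proof. by apply: ev_wtM0; rewrite // eq_sym. Qed.

Let f1_self : exists v, ev v * f1 * f1 = f1.
Proof. exact: ev_wt_self hc f1k. Qed.

Let f2_self : exists v, ev v * f2 * f2 = f2.
Proof. exact: ev_wt_self h'c f2k. Qed.

(** [t] is the sum of the units of the two diagonal corners. Since [(cas - c)^2] kills it, inserting
    [t] next to [f] places any product in the generalized eigenspace of [c]. *)
Lemma two_weights_absorb :
  exists t, t * f = f /\ f * t = f /\ killed c 2 t.
Proof.
have [v1 v1E] := f1_self.
have [v2 v2E] := f2_self.
exists (ev v1 * f1 + ev v2 * f2); split; last split.
- rewrite mulrDl !mulrDr v1E v2E -(mulrA (ev v1)) -(mulrA (ev v2)) f12 f21.
  by rewrite !mulr0 add0r addr0.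
- by rewrite mulrDr !mulrDl !(ev_mulCA v1) !(ev_mulCA v2) f12 f21 !mulr0 !add0r
    !addr0 (mulrA (ev v1)) v1E (mulrA (ev v2)) v2E.
- by rewrite /killed mulrDr (ev_mulCA v1) (ev_mulCA v2) f1k f2k !mulr0 addr0.
Qed.

Let S x := exists z, x = f * z * f.

(** The hypotheses express that [u] is a right multiple and [v] a left multiple of [f], in the form
    supplied by the unnormalised projections. *)
Let S_of a b u v z : f * a = (2 * p)%:R *: u -> b * f = (2 * p)%:R *: v ->
  S (u * z * v).
Proof.
move=> fa bf; exists ((2 * p)%:R ^-2 *: (a * z * b)).
transitivity ((2 * p)%:R ^-2 *: (f * a * z * (b * f))).
  rewrite fa bf -!scalerAl -scalerAr !scalerA -(mulrA (_ ^- 2)) -expr2.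
  by rewrite mulVf ?scale1r // expf_neq0.
by rewrite -scalerAr -scalerAl !mulrA.
Qed.

Let fw : f * wt w = (2 * p)%:R *: f1.
Proof.
by rewrite mulrDl -!mulrA wtM // wtM0 1?eq_sym // mulr0 addr0 -scalerAr.
Qed.

Let fw' : f * wt w' = (2 * p)%:R *: f2.
Proof. by rewrite mulrDl -!mulrA wtM // wtM0 // mulr0 add0r -scalerAr. Qed.

Let wf : wt w * f = (2 * p)%:R *: f1.
Proof.
by rewrite mulrDr wt_evM // mulrA -ev_comm -mulrA wtM0 // mulr0 addr0.
Qed.

Let w'f : wt w' * f = (2 * p)%:R *: f2.
Proof.
rewrite mulrDr wt_evM // mulrA -ev_comm -mulrA wtM0 1?eq_sym // mulr0.
by rewrite add0r.
Qed.

Let S_ev1 P : S (ev P * f1).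
Proof.
have [v vE] := f1_self.
suff -> : ev P * f1 = f1 * ev (P * v) * f1 by exact: S_of fw wf.
by rewrite -ev_comm rmorphM -(mulrA (ev P) (ev v)) -(mulrA (ev P)) vE.
Qed.

Let S_ev2 P : S (ev P * f2).
Proof.
have [v vE] := f2_self.
suff -> : ev P * f2 = f2 * ev (P * v) * f2 by exact: S_of fw' w'f.
by rewrite -ev_comm rmorphM -(mulrA (ev P) (ev v)) -(mulrA (ev P)) vE.
Qed.

Lemma two_weights_mem P :
  (exists z, ev P * f1 = f * z * f) /\ (exists z, ev P * f2 = f * z * f).
Proof. by split; [exact: S_ev1|exact: S_ev2]. Qed.

(** * Upper bound: a symmetric linear function of the corner is determined by three values *)

Section SymmetricForm.
Variable psi : U -> k.
Hypothesis psi_lin :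
  forall a x y, S x -> S y -> psi (a *: x + y) = a * psi x + psi y.
Hypothesis psi_sym : forall x y, S x -> S y -> psi (x * y) = psi (y * x).
Hypotheses (psi1 : psi f1 = 0) (psi2 : psi f2 = 0).
Hypothesis psi_y : psi (ev ('X - c%:P) * f1) = 0.

Let S0 : S 0. Proof. by exists 0; rewrite mulr0 mul0r. Qed.

Let psi0 : psi 0 = 0.
Proof.
have /eqP := psi_lin 1 S0 S0; rewrite scaler0 addr0 mul1r.
by rewrite -subr_eq0 opprD addrA subrr sub0r oppr_eq0 => /eqP.
Qed.

Let psiZ a x : S x -> psi (a *: x) = a * psi x.
Proof. by move=> Sx; have := psi_lin a Sx S0; rewrite psi0 !addr0. Qed.

Let psiD x y : S x -> S y -> psi (x + y) = psi x + psi y.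
Proof. by move=> Sx Sy; have := psi_lin 1 Sx Sy; rewrite scale1r mul1r. Qed.

Let SZ a x : S x -> S (a *: x).
Proof. by move=> [z ->]; exists (a *: z); rewrite -scalerAr -scalerAl. Qed.

(** One of the two factors in [ev v * f2 * f2 = f2] is moved to the front by symmetry, where it
    meets [f1] and [f2 * f1 = 0]. *)
Let psi12 z : psi (f1 * z * f2) = 0.
Proof.
have [v vE] := f2_self.
have Sf2 : S f2 by rewrite -[f2]mul1r -(rmorph1 ev); exact: S_ev2.
rewrite -{1}vE (mulrA _ _ f2) psi_sym //.
  by rewrite -(mulrA f1) (mulrA f2 f1) f21 mul0r psi0.
by rewrite (mulrA (f1 * z)) -(mulrA f1 z); exact: S_of fw w'f.
Qed.

Let psi21 z : psi (f2 * z * f1) = 0.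
Proof.
have [v vE] := f1_self.
have Sf1 : S f1 by rewrite -[f1]mul1r -(rmorph1 ev); exact: S_ev1.
rewrite -{1}vE (mulrA _ _ f1) psi_sym //.
  by rewrite -(mulrA f2) (mulrA f1 f2) f12 mul0r psi0.
by rewrite (mulrA (f2 * z)) -(mulrA f2 z); exact: S_of fw' wf.
Qed.

(** The root [c] is simple: of the two coincidences [j = s - 1] and [j = p - 1], only the first lies
    below [s]. *)
Let roots_down : exists2 G, G.[c] != 0 &
  \prod_(0 <= j < s) ('X - (casval (w / q ^+ (2 * j)))%:P) = G * ('X - c%:P).
Proof.
case/andP: s_bounds => s0 sp.
have cE j : (j < p)%N ->
    (c == casval (w / q ^+ (2 * j))) = (j == s.-1) || (j == p.-1).
  move=> jp; rewrite (casval_highest_eq p_gt1 q_prim (wt_neq0 w1) w2) //.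
  by rewrite s0 (ltnW sp).
exists (\prod_(0 <= j < s.-1) ('X - (casval (w / q ^+ (2 * j)))%:P)).
  rewrite horner_prod prodf_seq_neq0; apply/allP => j.
  rewrite mem_index_iota /= => js.
  by rewrite hornerXsubC subr_eq0 cE; lia.
rewrite -[in LHS](prednK s0) big_nat_recr //=; congr (_ * ('X - _%:P)).
by apply/esym/eqP; rewrite cE ?eqxx //; lia.
Qed.

(** As [w'] lies [s] steps below [w], these are the factors of [roots_down] in reverse order, and
    the root [c] now sits at [j = 0]. *)
Let roots_up : exists2 G, G.[c] != 0 &
  \prod_(0 <= j < s) ('X - (casval (w' * q ^+ (2 * j.+1)))%:P)
  = G * ('X - c%:P).
Proof.
case/andP: s_bounds => s0 sp.
have cE j : (j < s)%N -> (c == casval (w' * q ^+ (2 * j.+1))) = (j == 0)%N.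
  move=> js; have -> : w' * q ^+ (2 * j.+1) = w / q ^+ (2 * (s - j.+1)).
    rewrite /w' -mulrA; congr (_ * _); apply: (mulfI (qn0 (2 * s)%N)).
    rewrite mulrA mulfV // mul1r.
    have -> : q ^+ (2 * s) = q ^+ (2 * j.+1) * q ^+ (2 * (s - j.+1)).
      by rewrite -exprD -mulnDr subnKC.
    by rewrite mulfK.
  rewrite /c (casval_highest_eq p_gt1 q_prim (wt_neq0 w1) w2); last 2 first.
  - by rewrite s0 ltnW.
  - lia.
  by apply/orP/eqP => [[] /eqP|]; [lia|lia|move=> ->; left; apply/eqP; lia].
exists (\prod_(1 <= j < s) ('X - (casval (w' * q ^+ (2 * j.+1)))%:P)).
  rewrite horner_prod prodf_seq_neq0; apply/allP => j.
  rewrite mem_index_iota /= => js.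
  by rewrite hornerXsubC subr_eq0 cE; lia.
rewrite big_ltn // mulrC; congr (_ * ('X - _%:P)).
by apply/esym/eqP; rewrite cE.
Qed.

(* Both loops [f1 * E^s * f2 * F^s * f1] and [f2 * F^s * f1 * E^s * f2] are   *)
(* nonzero multiples of the nilpotent parts of their corners.                 *)
Let psi_y2 : psi (ev ('X - c%:P) * f2) = 0.
Proof.
have [G Gc GE] := roots_down; have [G' G'c G'E] := roots_up.
pose X := f2 * F ^+ s * f1; pose Y := f1 * E ^+ s * f2.
have f11 : f1 * f1 = (2 * p)%:R *: (ev h * f1).
  by rewrite /f1 -[X in _ * X]mulr1 ev_wtM // mulr1.
have f22 : f2 * f2 = (2 * p)%:R *: (ev h' * f2).
  by rewrite /f2 -[X in _ * X]mulr1 ev_wtM // mulr1.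
have wf1 : wt w * f1 = (2 * p)%:R *: f1 by exact: wt_evM.
have wf2 : wt w' * f2 = (2 * p)%:R *: f2 by exact: wt_evM.
have f1w : f1 * wt w = (2 * p)%:R *: f1 by rewrite -mulrA wtM // scalerAr.
have f2w : f2 * wt w' = (2 * p)%:R *: f2 by rewrite -mulrA wtM // scalerAr.
have NN (x y : U) : (2 * p)%:R *: x * (y * ((2 * p)%:R *: x))
    = (2 * p)%:R ^+ 2 *: (x * (y * x)).
  by rewrite -!scalerAr -scalerAl scalerA.
have XY : X * Y = ((2 * p)%:R ^+ 3 * (h * h * G' * h').[c]) *:
    (ev ('X - c%:P) * f2).
  have Ff1 : F ^+ s * f1 = ev h * (wt w' * F ^+ s).
    by rewrite /f1 mulrA -ev_comm -mulrA FX_wt.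
  have f1E : f1 * E ^+ s = ev h * (E ^+ s * wt w').
    by rewrite /f1 -mulrA wtEX.
  have FEf : F ^+ s * E ^+ s * f2 = ev (G' * ('X - c%:P)) * f2.
    by rewrite /f2 (ev_mulCA h' (F ^+ s * _)) FEX_wt // G'E -ev_mulCA.
  transitivity (ev (h * h) * ((f2 * wt w') * ((F ^+ s * E ^+ s) * (wt w' * f2)))).
    rewrite /X /Y -(mulrA f2 _ f1) Ff1 f1E ev_sandwich; congr (_ * _).
    by rewrite -!mulrA.
  rewrite f2w wf2 NN FEf (ev_mulCA _ f2 f2) f22.
  rewrite -!scalerAr scalerA -exprSr -scalerA -(killed_evM _ f2k).
  rewrite (mulrA (ev (G' * _))) (mulrA (ev (h * _))) -!rmorphM.
  by congr (_ *: (ev _ * _)); ring.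
have YX : Y * X = ((2 * p)%:R ^+ 3 * (h' * h' * G * h).[c]) *:
    (ev ('X - c%:P) * f1).
  have Ef2 : E ^+ s * f2 = ev h' * (wt w * E ^+ s).
    by rewrite /f2 mulrA -ev_comm -mulrA EX_wt /w' divfK.
  have f2F : f2 * F ^+ s = ev h' * (F ^+ s * wt w).
    by rewrite /f2 -mulrA wtFX /w' divfK.
  have EFf : E ^+ s * F ^+ s * f1 = ev (G * ('X - c%:P)) * f1.
    by rewrite /f1 (ev_mulCA h (E ^+ s * _)) EFX_wt // GE -ev_mulCA.
  transitivity (ev (h' * h') * ((f1 * wt w) * ((E ^+ s * F ^+ s) * (wt w * f1)))).
    rewrite /X /Y -(mulrA f1 _ f2) Ef2 f2F ev_sandwich; congr (_ * _).
    by rewrite -!mulrA.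
  rewrite f1w wf1 NN EFf (ev_mulCA _ f1 f1) f11.
  rewrite -!scalerAr scalerA -exprSr -scalerA -(killed_evM _ f1k).
  rewrite (mulrA (ev (G * _))) (mulrA (ev (h' * _))) -!rmorphM.
  by congr (_ *: (ev _ * _)); ring.
(* Symmetry carries the loop to the corner of [f1], where [psi_y] applies; the scalar in [XY] is
   nonzero. *)
have : psi (X * Y) = 0.
  by rewrite psi_sym ?YX ?psiZ ?psi_y ?mulr0 //; apply: S_of; eassumption.
rewrite XY psiZ // => /eqP; rewrite !hornerM !mulf_eq0 /=.
by rewrite !(negPf p2, negPf hc, negPf h'c, negPf G'c) /= => /eqP.
Qed.

(** The off-diagonal corners contribute nothing. A diagonal corner consists of polynomials in [cas]
    times [f1] or [f2], which reduce modulo [(cas - c)^2] to the four elements already treated. *)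
Lemma psi_eq0 z : psi (f * z * f) = 0.
Proof.
have -> : f * z * f = (f1 * z * f1 + f1 * z * f2) + (f2 * z * f1 + f2 * z * f2).
  by rewrite !mulrDl !mulrDr.
have SD x y : S x -> S y -> S (x + y).
  move=> [a ->] [b ->]; exists (a + b).
  by rewrite (mulrDr f a b) (mulrDl (f * a)).
have S11 := S_of z fw wf; have S12 := S_of z fw w'f.
have S21 := S_of z fw' wf; have S22 := S_of z fw' w'f.
rewrite (psiD (SD _ _ S11 S12) (SD _ _ S21 S22)) (psiD S11 S12) (psiD S21 S22).
rewrite psi12 psi21 addr0 add0r.
have [R1 ->] := ev_wt_corner h z w1; have [R2 ->] := ev_wt_corner h' z w'1.
have [d1 ->] := killed_ev2 R1 f1k; have [d2 ->] := killed_ev2 R2 f2k.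
have Sf1 : S f1 by rewrite -[f1]mul1r -(rmorph1 ev); exact: S_ev1.
have Sf2 : S f2 by rewrite -[f2]mul1r -(rmorph1 ev); exact: S_ev2.
have Sy1 := S_ev1 ('X - c%:P); have Sy2 := S_ev2 ('X - c%:P).
rewrite (psiD (SZ _ Sf1) (SZ _ Sy1)) (psiD (SZ _ Sf2) (SZ _ Sy2)) !psiZ //.
by rewrite psi1 psi2 psi_y psi_y2 !mulr0 !addr0.
Qed.

End SymmetricForm.
End TwoWeights.

End WeightCalculus.

(** * Dual numbers and matrix algebras over an extension of the scalars *)

(** The ring [R[t]/(t^2)], with [(x, y)] for [x + y t]; a separate name keeps it apart from the
    componentwise ring structure on pairs. *)
Definition dualnum (R : Type) : Type := (R * R)%type.

Section DualNumbers.
Variables (k : comNzRingType) (R : comAlgType k).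
Local Notation D := (dualnum R).

HB.instance Definition _ := GRing.Lmodule.copy D (R * R)%type.

Definition dualnum_mul (x y : D) : D := (x.1 * y.1, x.1 * y.2 + x.2 * y.1).
Definition dualnum_one : D := (1, 0).

Fact dualnum_mulA : associative dualnum_mul.
Proof. by move=> x y z; congr (_, _) => /=; ring. Qed.

Fact dualnum_mulC : commutative dualnum_mul.
Proof. by move=> x y; congr (_, _) => /=; ring. Qed.

Fact dualnum_mul1 : left_id dualnum_one dualnum_mul.
Proof. by move=> [x1 x2]; congr (_, _) => /=; ring. Qed.

Fact dualnum_mulD : left_distributive dualnum_mul +%R.
Proof. by move=> x y z; congr (_, _) => /=; ring. Qed.

Fact dualnum_one_neq0 : dualnum_one != 0.
Proof. 
apply/eqP => e; have /eqP : 1 = 0 :> R := congr1 fst e.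
by rewrite oner_eq0.
 Qed.

HB.instance Definition _ := GRing.Zmodule_isComNzRing.Build D
  dualnum_mulA dualnum_mulC dualnum_mul1 dualnum_mulD dualnum_one_neq0.

Fact dualnum_scaleAl (a : k) (x y : D) : a *: (x * y) = (a *: x : D) * y.
Proof. by apply: (f_equal2 pair); rewrite /= ?scalerDr !scalerAl. Qed.

HB.instance Definition _ := GRing.Lmodule_isLalgebra.Build k D dualnum_scaleAl.
HB.instance Definition _ := GRing.Lalgebra_isComAlgebra.Build k D.

End DualNumbers.

(* ['M[A]_n.+1] is canonically an algebra over [A] only. *)
Definition matalg (k : comNzRingType) (A : comAlgType k) (n : nat) : Type :=
  'M[A]_n.+1.

Section MatrixAlgebra.
Variables (k : comNzRingType) (A : comAlgType k) (n : nat).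
Local Notation M := (matalg A n).

HB.instance Definition _ := GRing.NzRing.copy M 'M[A]_n.+1.

Definition matalg_scale (a : k) (x : M) : M := a%:A *: (x : 'M[A]_n.+1).

Fact matalg_scaleA a b x :
  matalg_scale a (matalg_scale b x) = matalg_scale (a * b) x.
Proof. by rewrite /matalg_scale scalerA -scalerAl mul1r scalerA. Qed.

Fact matalg_scale1 : left_id 1 matalg_scale.
Proof. by move=> x; rewrite /matalg_scale !scale1r. Qed.

Fact matalg_scaleDr : right_distributive matalg_scale +%R.
Proof. by move=> a x y; rewrite /matalg_scale scalerDr. Qed.

Fact matalg_scaleDl x : {morph matalg_scale^~ x : a b / a + b}.
Proof. by move=> a b; rewrite /matalg_scale !scalerDl. Qed.

HB.instance Definition _ := GRing.Zmodule_isLmodule.Build k M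
  matalg_scaleA matalg_scale1 matalg_scaleDr matalg_scaleDl.

Fact matalg_scaleAl (a : k) (x y : M) : a *: (x * y) = (a *: x : M) * y.
Proof. exact: (@scalerAl A 'M[A]_n.+1 a%:A x y). Qed.

Fact matalg_scaleAr (a : k) (x y : M) : a *: (x * y) = x * (a *: y : M).
Proof. exact: (@scalerAr A 'M[A]_n.+1 a%:A x y). Qed.

HB.instance Definition _ := GRing.Lmodule_isLalgebra.Build k M matalg_scaleAl.
HB.instance Definition _ := GRing.Lalgebra_isAlgebra.Build k M matalg_scaleAr.

Lemma matalg_scaleE (a : k) (x : M) : a *: x = a%:A *: (x : 'M[A]_n.+1).
Proof. by []. Qed.

End MatrixAlgebra.

(** * Cyclic weighted shifts *)

Section WeightedShift.
Variables (A : comNzRingType) (n : nat).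
Local Notation I := 'I_n.+2.

Definition wshift (f : I -> A) : 'M[A]_n.+2 :=
  \matrix_(i, j) (f j *+ (i == j + 1)).

Lemma wshiftX f m (i j : I) :
  (wshift f ^+ m) i j = (\prod_(l < m) f (j + l%:R)) *+ (i == j + m%:R).
Proof.
elim: m i => [|m IH] i; first by rewrite big_ord0 addr0 expr0 mxE.
rewrite exprS [LHS]mxE (bigD1 (j + m%:R)) //= big1 => [|k kj]; last first.
  by rewrite IH (negPf kj) mulr0n mulr0.
rewrite IH eqxx mulr1n addr0 mxE big_ord_recr /= mulrC mulrnAr.
by rewrite -addrA -mulrSr.
Qed.

(** The power [n.+2] goes once round the cycle and collects every coefficient. *)
Lemma wshiftX0 f : \prod_i f i = 0 -> wshift f ^+ n.+2 = 0.
Proof.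
move=> f0; apply/matrixP => i j; rewrite wshiftX mxE.
have -> : \prod_(l < n.+2) f (j + l%:R) = \prod_i f i.
  rewrite [RHS](reindex_inj (addrI j)) /=; apply: eq_bigr => l _.
  by rewrite natr_Zp.
by rewrite f0 mul0rn.
Qed.

Lemma trmxX m (M : 'M[A]_n.+2) : (M ^+ m)^T = M^T ^+ m.
Proof.
elim: m => [|m IH]; first by rewrite !expr0 trmx1.
by rewrite exprS trmx_mul IH exprSr.
Qed.

Lemma wshift_trmul f g :
  (wshift g)^T *m wshift f = diag_mx (\row_i (g i * f i)).
Proof.
apply/matrixP => i j; rewrite !mxE (bigD1 (i + 1)) //= big1 => [|k ki].
  rewrite !mxE eqxx mulr1n addr0 (inj_eq (addIr 1)).
  by case: (eqVneq i j) => [->|]; rewrite ?mulr1n ?mulr0n ?mulr0.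
by rewrite !mxE (negPf ki) mulr0n mul0r.
Qed.

Lemma wshift_multr f g :
  wshift f *m (wshift g)^T = diag_mx (\row_i (f (i - 1) * g (i - 1))).
Proof.
apply/matrixP => i j; rewrite !mxE (bigD1 (i - 1)) //= big1 => [|k ki].
  rewrite !mxE subrK eqxx mulr1n addr0 eq_sym.
  by case: (eqVneq i j) => [->|]; rewrite ?mulr1n ?mulr0n ?mulr0.
rewrite !mxE (_ : (i == k + 1) = false) ?mulr0n ?mul0r //.
by apply: contraNF ki => /eqP ->; rewrite addrK.
Qed.

End WeightedShift.

(** * A deformed Verma module *)

Section DeformedVerma.
Variables (k : numFieldType) (n : nat) (q : k).
Local Notation p := n.+2.
Local Notation I := 'I_n.+2.
Hypothesis q_prim : (2 * p).-primitive_root q.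
Variables (A : comAlgType k) (a b : A) (s : nat) (w : k).
Hypotheses (s_bounds : (0 < s <= p)%N) (w1 : w ^+ (2 * p) = 1).
Hypothesis w2 : w ^+ 2 = q ^+ (2 * s.-1).
Hypothesis a_nil : (s < p)%N /\ a * a = 0 \/ a = 0.
Hypothesis b_nil : (s < p)%N /\ b * b = 0 \/ b = 0.

Let p_gt1 : (1 < p)%N. Proof. by []. Qed.
Let q0 : q != 0. Proof. exact: q_neq0 q_prim. Qed.
Let qn0 m : q ^+ m != 0. Proof. by rewrite expf_neq0. Qed.
Let qq1 : q * q - 1 != 0. Proof. exact: qq_neq1 q_prim. Qed.
Let w0 : w != 0. Proof. exact: wt_neq0 w1. Qed.

Definition vwt (i : I) : k := w / q ^+ (2 * i).

(* The two places where the Casimir eigenvalue kills the product of the steps *)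
(* of [E] and [F]; there the steps are deformed to [b] and [a], which shifts  *)
(* the Casimir element by [a * b] and must then also be done elsewhere.       *)
Definition wall (i : I) := (i == s.-1 :> nat) || (i == n.+1 :> nat).

Definition vcas : A := (casval q (w * q ^+ 2))%:A + a * b.

Definition vF (i : I) : A := if wall i then a else 1.

Definition vE (i : I) : A := if wall i then b else vcas - (casval q (vwt i))%:A.

Definition vdiag (d : I -> k) : matalg A n.+1 := diag_mx (\row_i (d i)%:A).

Definition vermaE : matalg A n.+1 := (wshift vE)^T.
Definition vermaF : matalg A n.+1 := wshift vF.
Definition vermaK : matalg A n.+1 := vdiag vwt.

Lemma vwt1 i : vwt i ^+ (2 * p) = 1. Proof. exact: wt_shiftV. Qed.

Let vwt0 i : vwt i != 0. Proof. exact: wt_neq0 (vwt1 i). Qed.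

Lemma vwtS (i : I) : vwt (i + 1) = vwt i / q ^+ 2.
Proof.
rewrite /vwt -mulrA -invfM -exprD -mulnSr; congr (_ / _).
have qp : (q ^+ 2) ^+ p = 1 by rewrite -exprM (prim_expr_order q_prim).
by rewrite !exprM -(expr_mod i.+1 qp) /= modnDmr addn1.
Qed.

Lemma wall_casval (i : I) : wall i -> casval q (w * q ^+ 2) = casval q (vwt i).
Proof.
move=> Wi; apply/eqP; rewrite /vwt.
by rewrite (casval_highest_eq p_gt1 q_prim w0 w2 s_bounds (ltn_ord i)).
Qed.

(** At a wall the scalar part of [vcas] cancels [casval q (vwt i)] and leaves [a * b], so the
    deformed steps obey the same formula as the others. *)
Lemma vEF i : vE i * vF i = vcas - (casval q (vwt i))%:A.
Proof.
rewrite /vE /vF; case: ifP => [Wi|_]; last by rewrite mulr1.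
by rewrite /vcas (wall_casval Wi) addrC addKr mulrC.
Qed.

(** For [s < p] the two walls are distinct and contribute [x * x]; for [s = p] they coincide, and
    the hypothesis forces [x = 0]. *)
Lemma prod_wall (x : A) (h : I -> A) :
  (s < p)%N /\ x * x = 0 \/ x = 0 -> (forall i, wall i -> h i = x) ->
  \prod_i h i = 0.
Proof.
move=> xn hx; rewrite (bigD1 ord_max) //= hx; last by rewrite /wall eqxx orbT.
case: xn => [[sp xx]|->]; last by rewrite mul0r.
have s_lt : (s.-1 < n.+1)%N by clear -s_bounds sp; lia.
rewrite (bigD1 (widen_ord (leqnSn _) (Ordinal s_lt))) /=.
  by rewrite hx ?/wall ?eqxx // mulrA xx mul0r.
by rewrite -val_eqE /= ltn_eqF.
Qed.

Lemma eq_vdiag d d' : d =1 d' -> vdiag d = vdiag d'.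
Proof. by move=> e; apply/matrixP => i j; rewrite !mxE e. Qed.

Lemma vdiagM d d' : vdiag d * vdiag d' = vdiag (fun i => d i * d' i).
Proof.
rewrite /vdiag [LHS]mulmx_diag; congr diag_mx; apply/rowP => i.
by rewrite !mxE -scalerAl mul1r scalerA.
Qed.

Lemma vdiag1 : vdiag (fun=> 1) = 1.
Proof. by apply/matrixP => i j; rewrite !mxE scale1r. Qed.

Lemma vdiagX d m : vdiag d ^+ m = vdiag (fun i => d i ^+ m).
Proof.
elim: m => [|m IH]; last first.
  by rewrite exprS IH vdiagM; apply: eq_vdiag => i; rewrite exprS.
by rewrite expr0 -vdiag1.
Qed.

Lemma vdiagD d d' : vdiag d + vdiag d' = vdiag (fun i => d i + d' i).
Proof. by apply/matrixP => i j; rewrite !mxE scalerDl mulrnDl. Qed.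

Lemma vdiagZ x d : x *: vdiag d = vdiag (fun i => x * d i).
Proof.
apply/matrixP => i j.
by rewrite matalg_scaleE !mxE mulrnAr -scalerAl mul1r scalerA.
Qed.

Lemma vermaEX : vermaE ^+ p = 0.
Proof.
rewrite /vermaE -[LHS]trmxX wshiftX0 ?trmx0 //.
by apply: (prod_wall b_nil) => i Wi; rewrite /vE Wi.
Qed.

Lemma vermaFX : vermaF ^+ p = 0.
Proof.
by apply: wshiftX0; apply: (prod_wall a_nil) => i Wi; rewrite /vF Wi.
Qed.

Lemma vermaKX : vermaK ^+ (2 * p) = 1.
Proof. by rewrite vdiagX -vdiag1; apply: eq_vdiag => i; rewrite vwt1. Qed.

Lemma vermaKV : vermaK ^+ (2 * p - 1) = vdiag (fun i => (vwt i)^-1).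
Proof.
rewrite vdiagX; apply: eq_vdiag => i; apply: (mulfI (vwt0 i)).
by rewrite -exprS mulfV // -(vwt1 i) subn1.
Qed.

Lemma vermaKE : vermaK * vermaE = q ^+ 2 *: (vermaE * vermaK).
Proof.
rewrite [vermaK * _]mul_diag_mx matalg_scaleE [vermaE * _]mul_mx_diag.
apply/matrixP => i j; rewrite !mxE; case: eqVneq => [->|]; last first.
  by rewrite mulr0n mul0r !mulr0.
by rewrite mulr1n vwtS -!scalerAl -scalerAr !mul1r mulr1 scalerA mulrC divfK.
Qed.

Lemma vermaKF : vermaK * vermaF = q ^- 2 *: (vermaF * vermaK).
Proof.
rewrite [vermaK * _]mul_diag_mx matalg_scaleE [vermaF * _]mul_mx_diag.
apply/matrixP => i j; rewrite !mxE; case: eqVneq => [->|]; last first.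
  by rewrite mulr0n mul0r !mulr0.
by rewrite mulr1n vwtS -!scalerAl -scalerAr !mul1r mulr1 scalerA mulrC.
Qed.

Lemma vermaEF_FE :
  vermaE * vermaF - vermaF * vermaE
  = (q - q^-1)^-1 *: (vermaK - vermaK ^+ (2 * p - 1)).
Proof.
have -> : vermaK ^+ (2 * p - 1) = (-1) *: vdiag (fun i => - (vwt i)^-1).
  by rewrite vermaKV vdiagZ; apply: eq_vdiag => i; rewrite mulN1r opprK.
rewrite scaleN1r opprK vdiagD vdiagZ [vermaE * _]wshift_trmul.
rewrite [vermaF * _]wshift_multr; apply/matrixP => i j; rewrite !mxE.
case: eqVneq => [_|]; last by rewrite !mulr0n subrr.
rewrite !mulr1n [vF _ * _]mulrC !vEF opprB addrC addrA subrK -scalerBl.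
(* [F E] at [i] is the step product at [i - 1]. The weights stay consistent across the wrap-around
   because [q ^+ (2 * p) = 1]. *)
have -> : vwt (i - 1) = vwt i * q ^+ 2.
  by rewrite -[in RHS](subrK 1 i) vwtS divfK.
congr (_ *: _); rewrite /casval; field.
by rewrite q0 qq1 vwt0.
Qed.

Definition vermaC : matalg A n.+1 :=
  vermaE * vermaF + ((q - q^-1) ^+ 2)^-1 *:
    (q^-1 *: vermaK + q *: vermaK ^+ (2 * p - 1)).

Lemma vermaCE : vermaC = vcas%:M.
Proof.
rewrite /vermaC vermaKV !vdiagZ vdiagD vdiagZ [vermaE * _]wshift_trmul.
apply/matrixP => i j; rewrite !mxE; case: eqVneq => [_|]; last first.
  by rewrite !mulr0n addr0.
by rewrite !mulr1n vEF mulrC subrK.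
Qed.

(** Each diagonal entry is a geometric sum in the ratio of two weights; it vanishes away from [i]
    because the [p] weights [vwt] are distinct. *)
Lemma verma_wt (i : I) :
  wt p vermaK (vwt i) = (2 * p)%:R *: delta_mx i i :> 'M[A]_p.
Proof.
have -> : wt p vermaK (vwt i)
    = vdiag (fun j => \sum_(l < 2 * p) (vwt j / vwt i) ^+ l).
  rewrite /wt big_mkord (eq_bigr (fun l : 'I__ =>
    vdiag (fun j => (vwt j / vwt i) ^+ l))) => [|l _]; last first.
    rewrite vdiagX vdiagZ; apply: eq_vdiag => j.
    by rewrite [RHS]exprMn mulrC.
  apply/matrixP => x y; rewrite summxE [RHS]mxE [X in _ = X *+ _]mxE.
  rewrite scaler_suml -sumrMnl.
  by apply: eq_bigr => l _; rewrite !mxE.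
apply/matrixP => x y; rewrite !mxE.
case: (eqVneq x i) => [->|xi] /=; last first.
  rewrite mulr0; suff -> : \sum_(l < 2 * p) (vwt x / vwt i) ^+ l = 0.
    by rewrite scale0r mul0rn.
  have z1 : vwt x / vwt i != 1.
    rewrite -(inj_eq (mulIf (vwt0 i))) divfK // mul1r /vwt.
    rewrite (inj_eq (mulfI w0)) (inj_eq invr_inj) (eq_prim_root_expr q_prim).
    by rewrite -!muln_modr eqn_pmul2l // !modn_small.
  apply: (mulfI (x := vwt x / vwt i - 1)); first by rewrite subr_eq0.
  by rewrite -subrX1 mulr0 exprMn exprVn !vwt1 invr1 mulr1 subrr.
rewrite (eq_bigr (fun=> 1)) => [|l _]; last first.
  by rewrite divff // expr1n.
rewrite sumr_const card_ord (eq_sym y) scaler_nat.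
by case: eqVneq; rewrite ?mulr1n ?mulr1 ?mulr0n ?mulr0.
Qed.

Lemma verma_horner P : horner_alg vermaC P = (horner_alg vcas P)%:M.
Proof.
elim/poly_ind: P => [|P x IH]; first by rewrite !rmorph0.
rewrite !rmorphD !rmorphM /= !horner_algX !horner_algC IH vermaCE.
rewrite -[_ * _]/(_ *m _) -scalar_mxM; congr (_ + _).
by rewrite matalg_scaleE scale_scalar_mx mulr1.
Qed.

(** * Block traces of a representation on the deformed Verma module *)

Section Traces.
Variables (U : algType k) (E F K : U) (rho : U -> matalg A n.+1).
Hypotheses (rhoD : {morph rho : x y / x + y}).
Hypotheses (rhoM : {morph rho : x y / x * y}) (rho1 : rho 1 = 1).
Hypothesis rhoZ : forall x, {morph rho : y / x *: y}.
Hypotheses (rhoE : rho E = vermaE) (rhoF : rho F = vermaF).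
Hypothesis rhoK : rho K = vermaK.
Hypothesis U_ind : forall S : U -> Prop, S E -> S F -> S K ->
  (forall x, S (x%:A)) -> (forall x y, S x -> S y -> S (x + y)) ->
  (forall x y, S x -> S y -> S (x * y)) -> forall x, S x.

Local Notation ev := (horner_alg (cas q E F K (K ^+ (2 * p - 1)))).

Definition btr (T : pred I) (x : U) : A := \sum_(i | T i) rho x i i.

Let rhoX m x : rho (x ^+ m) = rho x ^+ m.
Proof.
by elim: m => [|m IH]; rewrite ?expr0 // !exprS rhoM IH.
Qed.

Lemma rho_ev P : rho (ev P) = (horner_alg vcas P)%:M.
Proof.
rewrite -verma_horner; elim/poly_ind: P => [|P x IH].
  by rewrite !rmorph0 -[0 in LHS](scale0r 1) rhoZ scale0r.
rewrite !rmorphD !rmorphM /= !horner_algX !horner_algC rhoD rhoM IH rhoZ rho1.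
congr (_ * _ + _).
by rewrite /cas /vermaC !(rhoD, rhoM, rhoZ, rhoX) rhoE rhoF rhoK.
Qed.

Lemma rho_wt x : rho (wt p K x) = wt p vermaK x.
Proof.
rewrite /wt; elim/big_ind2: _ => [|x1 x2 y1 y2 <- <-|l _].
- by rewrite -[0 in LHS](scale0r 1) rhoZ scale0r.
- by rewrite rhoD.
- by rewrite rhoZ rhoX rhoK.
Qed.

Lemma btr_ev_wt (T : pred I) P (i : I) :
  btr T (ev P * wt p K (vwt i)) = ((2 * p)%:R * horner_alg vcas P) *+ T i.
Proof.
rewrite /btr rhoM rho_ev rho_wt verma_wt.
have -> : (horner_alg vcas P)%:M * ((2 * p)%:R *: delta_mx i i) =
    ((2 * p)%:R * horner_alg vcas P) *: delta_mx i i :> 'M[A]_p.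
  by rewrite [LHS]mul_scalar_mx scalerA mulrC.
case Ti: (T i).
  rewrite (bigD1 i) //= big1 => [|j /andP[_ ji]].
    by rewrite !mxE !eqxx mulr1 addr0.
  by rewrite !mxE (negPf ji) mulr0.
rewrite big1 // => j Tj; rewrite !mxE.
by case: eqVneq => [ji|]; [rewrite -ji Tj in Ti|rewrite mulr0].
Qed.

Lemma btrD T : {morph btr T : x y / x + y}.
Proof.
move=> x y; rewrite /btr rhoD -big_split.
by apply: eq_bigr => i _; rewrite mxE.
Qed.

Lemma btrZ T x y : btr T (x *: y) = x *: btr T y.
Proof.
rewrite /btr rhoZ scaler_sumr.
by apply: eq_bigr => i _; rewrite matalg_scaleE mxE mulr_algl.
Qed.

Definition block (T : pred I) := forall x i j, T i != T j -> rho x i j = 0.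

Lemma btr_sym T x y : block T -> btr T (x * y) = btr T (y * x).
Proof.
have btrM x' y' : block T -> btr T (x' * y')
    = \sum_(i | T i) \sum_(j | T j) rho x' i j * rho y' j i.
  move=> Tb; apply: eq_bigr => i Ti; rewrite rhoM mxE (bigID T) /=.
  by rewrite [X in _ + X]big1 ?addr0 // => j Tj; rewrite Tb ?mul0r // Ti.
move=> Tb; rewrite !btrM // exchange_big; apply: eq_bigr => i _.
by apply: eq_bigr => j _; rewrite mulrC.
Qed.

Lemma block_all : block predT. Proof. by []. Qed.

(** The only steps of the cycle that join the indices below [s] to the others are those at the
    walls, and their coefficients are now zero. *)
Lemma block_low : a = 0 -> b = 0 -> block (fun i => (i < s)%N).
Proof.
move=> a0 b0 x; set T := fun i : I => (i < s)%N.
have Twall (i : I) : T i != T (i + 1) -> wall i.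
  rewrite /T /wall /= modnDmr addn1; have := ltn_ord i.
  case: (eqVneq (i : nat) n.+1) => [->|ni] ip; first by rewrite orbT.
  by rewrite modn_small; clear -s_bounds ni ip; lia.
elim/U_ind: x => [||||x y IHx IHy|x y IHx IHy].
- move=> i j Tij; rewrite rhoE !mxE; case: eqVneq => // ji.
  by rewrite /vE Twall ?b0 ?mul0rn // -ji.
- move=> i j Tij; rewrite rhoF !mxE; case: eqVneq => // ij.
  by rewrite /vF Twall ?a0 ?mul0rn // -ij eq_sym.
- move=> i j Tij; rewrite rhoK !mxE; case: eqVneq => // ij.
  by rewrite ij eqxx in Tij.
- move=> x i j Tij; rewrite rhoZ rho1 matalg_scaleE !mxE.
  by case: eqVneq => [ij|]; rewrite ?mulr0 //; rewrite ij eqxx in Tij.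
- by move=> i j Tij; rewrite rhoD mxE IHx ?IHy ?addr0.
- move=> i j Tij; rewrite rhoM mxE big1 // => l _.
  case: (eqVneq (T i) (T l)) => [Til|/IHx ->]; last by rewrite mul0r.
  have Tlj : T l != T j by rewrite -Til.
  by rewrite (IHy _ _ Tlj) mulr0.
Qed.

Lemma block_high : a = 0 -> b = 0 -> block (fun i => (s <= i)%N).
Proof.
move=> a0 b0 x i j Tij; apply: block_low => //.
by rewrite !(ltnNge _ s) (inj_eq negb_inj).
Qed.

End Traces.

End DeformedVerma.

(** * The idempotents as polynomials in the Casimir element *)

Section PrimitiveRoot.
Variables (R : realType) (p : nat) (hp : (2 <= p)%N).
Local Notation q := (q R p).

Lemma qX m : q ^+ m =
  Complex (cos (m%:R * (pi / p%:R))) (sin (m%:R * (pi / p%:R))).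
Proof.
elim: m => [|m IH]; first by rewrite mul0r cos0 sin0.
rewrite exprS IH; set x := pi / p%:R.
have -> : m.+1%:R * x = x + m%:R * x by rewrite -natr1; ring.
rewrite cosD sinD /q -/x.
by simpc; congr Complex; ring.
Qed.

Lemma q_primitive : (2 * p).-primitive_root q.
Proof.
have p0 : 0 < p%:R :> R by rewrite ltr0n ltnW.
have q2p : q ^+ (2 * p) = 1.
  rewrite qX.
  have -> : (2 * p)%:R * (pi / p%:R) = pi *+ 2 :> R.
    by rewrite natrM -[RHS]mulr_natl; field; rewrite gt_eqF.
  by rewrite cos2pi sin2pi.
apply/andP; split; first by rewrite muln_gt0 /=; exact: ltnW.
apply/forallP => i; rewrite unity_rootE; apply/eqP.
case: (eqVneq i.+1 (2 * p)%N) => [->|ip]; first by rewrite q2p eqxx.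
have i2p : (i.+1 < 2 * p)%N by rewrite ltn_neqAle ip ltn_ord.
(* Half the angle of [q ^+ i.+1]: it lies strictly between [0] and [pi], whereas [q ^+ i.+1 = 1]
   would force [sin t = 0]. *)
pose t := i.+1%:R * (pi / p%:R) / 2 : R.
have sint : 0 < sin t.
  apply: sin_gt0_pi; apply/andP; split.
    by rewrite !mulr_gt0 ?invr_gt0 ?pi_gt0.
  rewrite -subr_gt0.
  have -> : pi - t = pi * ((2 * p)%:R - i.+1%:R) / (2 * p%:R).
    by rewrite /t natrM; field; rewrite gt_eqF.
  by rewrite !mulr_gt0 ?invr_gt0 ?pi_gt0 ?mulr_gt0 // subr_gt0 ltr_nat.
apply/negbTE; apply: contraTN sint => /eqP; rewrite qX => -[cos1 _].
have : cos (t *+ 2) = 1 by rewrite -mulr_natr divfK // pnatr_eq0.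
rewrite cos_mulr2n => cos2.
have : cos t ^+ 2 = 1 by lra.
rewrite -[X in X = _](addrK (sin t ^+ 2)) cos2Dsin2.
move=> sin2; have : sin t ^+ 2 == 0 by apply/eqP; lra.
by rewrite sqrf_eq0 => /eqP ->; rewrite ltxx.
Qed.

End PrimitiveRoot.

(* Newton interpolation; it turns the sum defining [b0] into a product of     *)
(* linear factors in the Casimir element.                                     *)
Lemma newton_shift (k : comNzRingType) (y : nat -> k) (d : nat) :
  \prod_(0 <= i < d) ('X - (y i.+1)%:P)
  = \sum_(0 <= j < d.+1)
      (\prod_(j <= i < d) (y 0 - y i.+1)) *: \prod_(0 <= i < j) ('X - (y i)%:P).
Proof.
elim: d => [|d IH].
  by rewrite big_nat1 !big_geq // scale1r.
rewrite big_nat_recr // [RHS]big_nat_recr //= [X in _ + X *: _]big_geq //.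
rewrite scale1r [X in _ = _ + X]big_nat_recl // mulrC.
have -> : 'X - (y d.+1)%:P = ('X - (y 0)%:P) + (y 0 - y d.+1)%:P.
  by rewrite rmorphB addrA subrK.
rewrite mulrDl addrC; congr (_ + _); rewrite IH mulr_sumr.
apply: eq_big_nat => j /andP[_ jd].
by rewrite mul_polyC scalerA [in RHS]big_nat_recr //= mulrC.
Qed.

Section QuantumGroup.
Variables (R : realType) (p : nat) (hp : (2 <= p)%N).
Local Notation C := R[i].
Local Notation U := (uqsl2 R hp).
Local Notation q := (q R p).
Local Notation E := (uqE R hp).
Local Notation F := (uqF R hp).
Local Notation K := (uqK R hp).
Local Notation Ki := (uqKinv R hp).
Local Notation ev := (horner_alg (cas q E F K Ki)).

Lemma uq_ind (S : U -> Prop) : S E -> S F -> S K -> (forall a, S (a%:A)) ->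
  (forall x y, S x -> S y -> S (x + y)) ->
  (forall x y, S x -> S y -> S (x * y)) -> forall x, S x.
Proof.
move=> SE SF SK SC SD SM x; rewrite -(repK x).
elim: (rep x) => [[]|a|t IHt u IHu|t IHt u IHu] //.
- by rewrite cls_cst; exact: SC.
- by rewrite cls_add; exact: SD.
- by rewrite cls_mul; exact: SM.
Qed.

Lemma uq_KKi : K * Ki = 1. Proof. by case: (uqsl2_relations R hp) => _ []. Qed.
Lemma uq_KiK : Ki * K = 1. Proof. by case: (uqsl2_relations R hp) => _ []. Qed.

Lemma uq_KE : K * E = q ^+ 2 *: (E * K).
Proof.
case: (uqsl2_relations R hp) => _ [_ KiK KEK _ _].
by rewrite scalerAl -KEK -[RHS]mulrA KiK mulr1.
Qed.

Lemma uq_KF : K * F = q ^- 2 *: (F * K).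
Proof.
case: (uqsl2_relations R hp) => _ [_ KiK _ KFK _].
by rewrite scalerAl -KFK -[RHS]mulrA KiK mulr1.
Qed.

Lemma uq_EF : E * F - F * E = (q - q^-1)^-1 *: (K - Ki).
Proof. by case: (uqsl2_relations R hp) => _ []. Qed.

Lemma uq_EX : E ^+ p = 0. Proof. by case: (uqsl2_relations R hp) => -[]. Qed.
Lemma uq_FX : F ^+ p = 0. Proof. by case: (uqsl2_relations R hp) => -[]. Qed.
Lemma uq_KX : K ^+ (2 * p) = 1.
Proof. by case: (uqsl2_relations R hp) => -[]. Qed.

Section Idempotent.
Variable eps : C.
Hypothesis eps2 : eps ^+ 2 = 1.

(** The weight onto which [v eps s] projects, the highest weight of the [s]-dimensional simple
    module of sign [eps]. *)
Definition weight (s : nat) : C := eps * q ^+ s.-1.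

Let q_prim := q_primitive R hp.
Let q0 : q != 0. Proof. exact: q_neq0 q_prim. Qed.
Let qn0 n : q ^+ n != 0. Proof. by rewrite expf_neq0. Qed.
Let qq1 : q * q - 1 != 0. Proof. exact: qq_neq1 q_prim. Qed.

Lemma eps_neq0 : eps != 0.
Proof. by rewrite -sqrf_eq0 eps2 oner_eq0. Qed.

Lemma epsV : eps^-1 = eps.
Proof. by apply: (mulfI eps_neq0); rewrite mulfV ?eps_neq0 // -expr2. Qed.

Lemma weight1 s : weight s ^+ (2 * p) = 1.
Proof.
rewrite exprMn exprM eps2 expr1n mul1r -exprM mulnC exprM.
by rewrite (prim_expr_order q_prim) expr1n.
Qed.

Lemma weight2 s : weight s ^+ 2 = q ^+ (2 * s.-1).
Proof. by rewrite exprMn eps2 mul1r -exprM mulnC. Qed.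

Lemma v_wt s : v R hp eps s = wt p K (weight s).
Proof.
apply: eq_bigr => l _; congr (_ ^+ _ *: _).
by rewrite /weight invfM epsV.
Qed.

Let node s j := casval q (weight s / q ^+ (2 * j)).
Let top s := casval q (weight s * q ^+ 2).
Let N s m := \prod_(0 <= j < m) ('X - (node s j)%:P).

Let EFv n s : E ^+ n * F ^+ n * v R hp eps s = ev (N s n) * wt p K (weight s).
Proof.
rewrite v_wt; apply: (EFX_wt hp q_prim uq_KX uq_KKi uq_KiK uq_KE uq_KF uq_EF).
  exact: uq_ind.
exact: weight1.
Qed.

Let top_node s j : (0 < s <= p)%N -> (j < p)%N ->
  (top s == node s j) = (j == s.-1) || (j == p.-1).
Proof.
by apply: (casval_highest_eq hp q_prim) (weight2 s); exact: wt_neq0 (weight1 s).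
Qed.

Lemma casval_eps x : casval q (eps * x) = eps * casval q x.
Proof. by rewrite /casval invfM epsV; ring. Qed.

Lemma qp : q ^+ p = -1.
Proof.
have /eqP : (q ^+ p) ^+ 2 = 1 by rewrite -exprM mulnC (prim_expr_order q_prim).
rewrite sqrf_eq1 => /orP[|/eqP //]; rewrite -(prim_order_dvd q_prim).
by move=> /dvdn_leq; have := hp; lia.
Qed.

Lemma qint_neq0 n : (0 < n < p)%N -> qint R p n != 0.
Proof.
move=> /andP[n0 np]; rewrite /qint mulf_neq0 ?invr_neq0 ?subr_eq0 //.
  rewrite -(inj_eq (mulfI (qn0 n))) mulfV // -exprD addnn -mul2n.
  by rewrite (q2_eq1 q_prim) gtnNdvd.
by rewrite -subr_eq0 (q_subV_neq0 hp q_prim).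
Qed.

(** By [q ^+ p = -1] the factor [[p - s - n]] equals [[s + n]], and a difference of Casimir values
    is a product of two quantum integers. This identifies the coefficients of [b0] with those of
    [newton_shift]. *)
Let cnegE s n : (0 < s)%N -> (n < p - s)%N ->
  cneg p eps s n = top s - node s (s.-1 + n).
Proof.
move=> s0 nps; rewrite /top /node /weight -[_ * _ * q ^+ 2]mulrA -mulrA.
rewrite !casval_eps.
have -> : q ^+ s.-1 * q ^+ 2 = q ^+ s * q.
  by rewrite -exprD -exprSr; congr (_ ^+ _); lia.
have -> : q ^+ s.-1 / q ^+ (2 * (s.-1 + n)) = q / (q ^+ s * q ^+ n * q ^+ n).
  apply: (mulfI (qn0 (2 * (s.-1 + n)))); rewrite mulrCA mulfV // mulr1.
  apply: (mulIf (mulf_neq0 (mulf_neq0 (qn0 s) (qn0 n)) (qn0 n))).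
  rewrite -[RHS]mulrA divfK ?mulf_neq0 // -!exprD -exprSr.
  by congr (_ ^+ _); lia.
rewrite /cneg /qint.
have -> : q ^+ (p - s - n) = - (q ^+ s * q ^+ n)^-1.
  apply: (mulIf (mulf_neq0 (qn0 s) (qn0 n))).
  rewrite mulNr mulVf ?mulf_neq0 // -!exprD -qp; congr (_ ^+ _); lia.
by rewrite /casval; field; rewrite q0 qq1 !qn0.
Qed.

Lemma gamma_neq0 s : (0 < s < p)%N -> gamma p eps s != 0.
Proof.
move=> sp; rewrite /gamma !mulf_neq0 //.
- by rewrite pnatr_eq0 muln_eq0 /=; lia.
- rewrite prodf_seq_neq0; apply/allP => i; rewrite mem_index_iota /= => ip.
  apply: mulf_neq0; first by rewrite oppr_eq0 eps_neq0.
  by apply: mulf_neq0; apply: qint_neq0; lia.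
- rewrite prodf_seq_neq0; apply/allP => i; rewrite mem_index_iota /= => ip.
  by apply: mulf_neq0 eps_neq0 _; apply: mulf_neq0; apply: qint_neq0; lia.
Qed.

Let Ncat s m d :
  N s (m + d) = N s m * \prod_(0 <= i < d) ('X - (node s (m + i))%:P).
Proof.
rewrite /N (big_cat_nat (leq0n m) (leq_addr d m)); congr (_ * _).
by rewrite -{1}[m]add0n big_addn addKn; apply: eq_bigr => i _; rewrite addnC.
Qed.

(** Nilpotency of [E] yields the annihilating polynomial from which the exponents in [e_middle] and
    [e_top] are read off. *)
Let Np s : ev (N s p) * wt p K (weight s) = 0.
Proof. by rewrite -EFv uq_EX !mul0r. Qed.

(** On the weight space [b0] is [M(cas)] and [a0] is [M(cas) (cas - top)], while [M ('X - top)^2] is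
    the annihilating [N s p]. As [M] omits both nodes equal to [top s], the value of [h] there is
    [M(top) / gamma], which is nonzero. *)
Lemma e_middle s : (0 < s < p)%N -> exists h : {poly C},
  [/\ e R hp eps s = ev h * wt p K (weight s), h.[top s] != 0 &
      ev (('X - (top s)%:P) ^+ 2) * e R hp eps s = 0].
Proof.
move=> sp; case/andP: (sp) => s0 s_lt.
pose d := (p.-1 - s)%N; pose y i := node s (s.-1 + i).
have topE : top s = y 0 by apply/eqP; rewrite /y top_node; lia.
pose M := N s s.-1 * \prod_(0 <= i < d) ('X - (y i.+1)%:P).
have NM : N s p.-1 = M * ('X - (top s)%:P).
  have -> : p.-1 = (s.-1 + d.+1)%N by rewrite /d; lia.
  by rewrite Ncat big_nat_recl // topE mulrA mulrAC.
have NM2 : N s p = M * ('X - (top s)%:P) ^+ 2.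
  have pE : p = (p.-1 + 1)%N by rewrite addn1 prednK // ltnW.
  rewrite {1}pE Ncat NM big_nat1 addn0 expr2 mulrA; congr (_ * ('X - _%:P)).
  by apply/esym/eqP; rewrite top_node; lia.
have b0E : b0 R hp eps s = ev M * wt p K (weight s).
  rewrite /b0 (_ : M = \sum_(1 <= n < (p - s).+1)
    alpha p eps s n *: N s (p - 1 - n)); last first.
    (* The Newton sum over [j] matches the sum defining [b0] under [n = d + 1 - j]. *)
    rewrite /M newton_shift mulr_sumr [RHS]big_add1 [RHS]big_nat_rev /=.
    have -> : (p - s)%N = d.+1 by rewrite /d; lia.
    apply: eq_big_nat => j /andP[_ jd]; rewrite -scalerAr -Ncat.
    congr (_ *: N s _); last by rewrite /d in jd *; lia.
    rewrite /alpha; have -> : (p - s)%N = d.+1 by rewrite /d; lia.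
    have -> : (d.+1 - (0 + d.+1 - j.+1).+1.-1)%N = j.+1 by lia.
    rewrite big_add1 /=; apply: eq_big_nat => i ijd.
    by rewrite cnegE ?topE //; rewrite /d in ijd; lia.
  rewrite raddf_sum mulr_suml; apply: eq_bigr => n _.
  by rewrite EFv /= evZ scalerAl.
have a0E : a0 R hp eps s = ev (N s p.-1) * wt p K (weight s) by exact: EFv.
exists ((gamma p eps s)^-1 *: (M - (delta p eps s / gamma p eps s) *: N s p.-1)).
have eE : e R hp eps s = ev ((gamma p eps s)^-1 *:
  (M - (delta p eps s / gamma p eps s) *: N s p.-1)) * wt p K (weight s).
  rewrite /e ltn_eqF // b0E a0E evZ rmorphB /= evZ.
  by rewrite -scalerAl mulrBl -scalerAl.
split => //.
  rewrite hornerZ mulf_neq0 ?invr_neq0 ?gamma_neq0 //.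
  rewrite NM hornerD hornerN hornerZ [(M * _).[_]]hornerM hornerXsubC subrr.
  rewrite !mulr0 subr0 hornerM mulf_neq0 // horner_prod prodf_seq_neq0.
    apply/allP => j; rewrite mem_index_iota /= => js.
    by rewrite hornerXsubC subr_eq0 top_node; lia.
  apply/allP => j; rewrite mem_index_iota /= => js.
  by rewrite hornerXsubC subr_eq0 top_node; rewrite /d in js *; lia.
rewrite eE mulrA -rmorphM NM.
rewrite (_ : _ * _ = ((gamma p eps s)^-1 *:
  (1 - (delta p eps s / gamma p eps s) *: ('X - (top s)%:P))) * N s p).
  by rewrite rmorphM -mulrA Np mulr0.
by rewrite NM2 -!mul_polyC; ring.
Qed.

(** For [s = p] the two nodes equal to [top] merge into [j = p - 1], so a first power of [cas - top]
    suffices. *)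
Lemma e_top : exists h : {poly C},
  [/\ e R hp eps p = ev h * wt p K (weight p), h.[top p] != 0 &
      ev ('X - (top p)%:P) * e R hp eps p = 0].
Proof.
pose g := (2 * p)%:R * \prod_(1 <= i < p) cpos p eps p i.
have g0 : g != 0.
  rewrite /g mulf_neq0 ?pnatr_eq0 ?muln_eq0 /=; [by []|lia|].
  rewrite prodf_seq_neq0; apply/allP => i; rewrite mem_index_iota /= => ip.
  by apply: mulf_neq0 eps_neq0 _; apply: mulf_neq0; apply: qint_neq0; lia.
have eE : e R hp eps p = ev (g^-1 *: N p p.-1) * wt p K (weight p).
  by rewrite /e eqxx evZ -scalerAl -EFv.
exists (g^-1 *: N p p.-1); split => //.
  rewrite hornerZ mulf_neq0 ?invr_neq0 // horner_prod prodf_seq_neq0.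
  apply/allP => j; rewrite mem_index_iota /= => js.
  by rewrite hornerXsubC subr_eq0 top_node; lia.
rewrite eE mulrA -rmorphM -scalerAr /= evZ -scalerAl.
have -> : ('X - (top p)%:P) * N p p.-1 = N p p.
  have pE : p = (p.-1 + 1)%N by rewrite addn1 prednK // ltnW.
  rewrite {5}pE Ncat big_nat1 addn0 mulrC; congr (_ * ('X - _%:P)).
  by apply/eqP; rewrite top_node; lia.
by rewrite Np scaler0.
Qed.

End Idempotent.
End QuantumGroup.

(** The values at the [x j] fix the coordinates through the invertible matrix; what remains of [psi]
    after subtracting the resulting combination vanishes at every [x j], hence on [S]. *)
Lemma slf_dim_of_dual (k : fieldType) (A : algType k) (S : set A) (n : nat)
    (phi : 'I_n -> A -> k) (x : 'I_n -> A) :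
  (forall i, is_slf S (phi i)) -> (forall j, S (x j)) ->
  \det (\matrix_(i, j) phi i (x j)) != 0 ->
  (forall psi, is_slf S psi -> (forall j, psi (x j) = 0) ->
     forall y, S y -> psi y = 0) ->
  slf_dim S n.
Proof.
set M := \matrix_(i, j) _ => phiS Sx detM vanish.
have Mu : M \in unitmx by rewrite unitmxE unitfE.
exists phi; split=> // psi psiS.
have coordE c j : (c *m M) 0 j = \sum_(i < n) c 0 i * phi i (x j).
  by rewrite mxE; apply: eq_bigr => i _; rewrite mxE.
exists ((\row_j psi (x j)) *m invmx M); split=> [y Sy|c cE]; last first.
  rewrite (_ : \row_j psi (x j) = c *m M) ?mulmxK //.
  by apply/rowP => j; rewrite coordE mxE cE.
set c := _ *m _; pose psi' z := psi z - \sum_(i < n) c 0 i * phi i z.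
apply/eqP; rewrite -subr_eq0; apply/eqP; apply: (vanish psi') => // [|j].
  split=> [a y1 y2 Sy1 Sy2|y1 y2 Sy1 Sy2]; rewrite /psi'.
    rewrite psiS.1 // mulrBr mulr_sumr -!addrA; congr (_ + _).
    rewrite addrCA; congr (_ + _); rewrite -opprD -big_split /=; congr (- _).
    by apply: eq_bigr => i _; rewrite (phiS i).1 // mulrDr mulrCA.
  rewrite psiS.2 //; congr (_ - _); apply: eq_bigr => i _.
  by rewrite (phiS i).2.
by rewrite /psi' -coordE mulmxKV // mxE subrr.
Qed.

Lemma horner_alg_dualnum1 (k : comNzRingType) (A : comAlgType k)
    (x : dualnum A) P : (horner_alg x P).1 = horner_alg x.1 P.
Proof.
elim/poly_ind: P => [|P c IH]; first by rewrite !rmorph0.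
rewrite !rmorphD !rmorphM /= !horner_algX !horner_algC -IH.
by [].
Qed.

Lemma horner_alg_regular (k : fieldType) (x : k^o) P :
  horner_alg x P = P.[x].
Proof.
elim/poly_ind: P => [|P c IH]; first by rewrite !rmorph0 horner0.
rewrite !rmorphD !rmorphM /= !horner_algX !horner_algC IH.
by rewrite hornerD hornerM hornerX hornerC [c%:A]mulr1.
Qed.

Section VermaTrace.
Variables (R : realType) (n : nat) (hp : (2 <= n.+2)%N).
Local Notation p := n.+2.
Local Notation U := (uqsl2 R hp).
Local Notation q := (q R p).
Local Notation E := (uqE R hp).
Local Notation F := (uqF R hp).
Local Notation K := (uqK R hp).
Local Notation Ki := (uqKinv R hp).
Local Notation ev := (horner_alg (cas q E F K Ki)).

(** Everything needed from the deformed Verma module: the full trace is symmetric for all admissible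
    [a] and [b], the two block traces when [a = b = 0]. *)
Lemma verma_trace (A : comAlgType R[i]) (a b : A) (s : nat) (w : R[i]) :
  (0 < s <= p)%N -> w ^+ (2 * p) = 1 -> w ^+ 2 = q ^+ (2 * s.-1) ->
  (s < p)%N /\ a * a = 0 \/ a = 0 -> (s < p)%N /\ b * b = 0 \/ b = 0 ->
  exists tau : pred 'I_p -> U -> A,
  [/\ forall T x y, tau T (x + y) = tau T x + tau T y,
      forall T c x, tau T (c *: x) = c *: tau T x,
      forall T P (i : 'I_p), tau T (ev P * wt p K (w / q ^+ (2 * i)))
        = ((2 * p)%:R * horner_alg (vcas q a b w) P) *+ T i,
      forall x y, tau predT (x * y) = tau predT (y * x) &
      a = 0 -> b = 0 -> forall x y,
        tau (fun i => (i < s)%N) (x * y) = tau (fun i => (i < s)%N) (y * x) /\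
        tau (fun i => (s <= i)%N) (x * y) = tau (fun i => (s <= i)%N) (y * x)].
Proof.
move=> sp w1 w2 an bn.
have qp := q_primitive R hp.
have eX := vermaEX q a w sp bn; have fX := vermaFX sp an.
have cX := vermaKX qp A w1.
have cc : vermaK n q A w * vermaK n q A w ^+ (2 * p - 1) = 1.
  by rewrite -exprS -[RHS]cX; congr (_ ^+ _); lia.
have ce : vermaK n q A w * vermaE n q a b s w * vermaK n q A w ^+ (2 * p - 1)
    = q ^+ 2 *: vermaE n q a b s w.
  by rewrite (vermaKE qp) -scalerAl -mulrA cc mulr1.
have cf : vermaK n q A w * vermaF n a s * vermaK n q A w ^+ (2 * p - 1)
    = q ^- 2 *: vermaF n a s.
  by rewrite (vermaKF qp) -scalerAl -mulrA cc mulr1.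
have ef := vermaEF_FE qp a b sp w1 w2.
pose rho := @uq_lift R p hp _ (vermaE n q a b s w) (vermaF n a s)
  (vermaK n q A w).
have [rE rF rK] := @uq_lift_gen R p hp _ _ _ _ eX fX cX ce cf ef.
have rD := @uq_liftD R p hp _ _ _ _ eX fX cX ce cf ef.
have rM := @uq_liftM R p hp _ _ _ _ eX fX cX ce cf ef.
have r1 := @uq_lift1 R p hp _ _ _ _ eX fX cX ce cf ef.
have rZ := @uq_liftZ R p hp _ _ _ _ eX fX cX ce cf ef.
exists (fun T => @btr _ n A U rho T); split.
- by move=> T x y; exact: btrD.
- by move=> T c x; exact: btrZ.
- move=> T P i; exact: (btr_ev_wt qp sp w1 w2 rD rM r1 rZ rE rF rK).
- by move=> x y; apply: btr_sym => //; exact: block_all.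
- move=> a0 b0 x y; split; apply: btr_sym => //.
    exact: (block_low sp rD rM r1 rZ rE rF rK (@uq_ind R p hp)).
  exact: (block_high sp rD rM r1 rZ rE rF rK (@uq_ind R p hp)).
Qed.

End VermaTrace.

(** * Symmetric linear functions of the basic algebras *)

Section Dimensions.
Variables (R : realType) (n : nat) (hp : (2 <= n.+2)%N).
Local Notation p := n.+2.
Local Notation C := R[i].
Local Notation U := (uqsl2 R hp).
Local Notation q := (q R p).
Local Notation E := (uqE R hp).
Local Notation F := (uqF R hp).
Local Notation K := (uqK R hp).
Local Notation Ki := (uqKinv R hp).
Local Notation ev := (horner_alg (cas q E F K Ki)).
(** The algebra generated by [a] and [b] with [a^2 = b^2 = 0]: [x.1.1] is the constant term of [x],
    and [x.2.2] is its coefficient of [a b]. *)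
Local Notation A := (dualnum (dualnum C^o)).

Let q_prim := q_primitive R hp.
Let KX := uq_KX R hp.
Let KKi := uq_KKi R hp.
Let KiK := uq_KiK R hp.
Let KE := uq_KE R hp.
Let KF := uq_KF R hp.
Let EF := uq_EF R hp.
Let EX := uq_EX R hp.
Let FX := uq_FX R hp.
Let ind := @uq_ind R p hp.

Let p2 : (2 * p)%:R != 0 :> C.
Proof. by rewrite pnatr_eq0. Qed.

(** Replacing [z] by [z * t] leaves the product unchanged and moves the middle factor into [Q],
    since [cas] is central. *)
Lemma B_corner s m t : t * basic_idem R hp s = basic_idem R hp s ->
  ev (('X - (beta R p s)%:P) ^+ m) * t = 0 ->
  forall x, B R hp s x <->
    exists z, x = basic_idem R hp s * z * basic_idem R hp s.
Proof.
move=> tf tk x; split=> [[z _ <-]|[z ->]]; first by exists z.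
exists (z * t); last by rewrite mulrA -(mulrA _ t) tf.
exists m; have -> : casimir R hp - (beta R p s)%:A = ev ('X - (beta R p s)%:P).
  by rewrite rmorphB /= horner_algX horner_algC.
rewrite -rmorphXn mulrA (ev_comm hp q_prim KKi KiK KE KF EF ind) -mulrA.
by rewrite tk mulr0.
Qed.

Let trace_slf (tau : U -> A) (l : A -> C) (S : set U) :
  (forall x y, tau (x + y) = tau x + tau y) ->
  (forall c x, tau (c *: x) = c *: tau x) ->
  (forall x y, tau (x * y) = tau (y * x)) ->
  (forall c x y, l (c *: x + y) = c * l x + l y) ->
  is_slf S (l \o tau).
Proof.
move=> tD tZ tM lL; split=> [c x y _ _|x y _ _] /=; last by rewrite tM.
by rewrite tD tZ lL.
Qed.

Let natM11 m (x : A) : (m%:R * x).1.1 = m%:R * x.1.1 :> C.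
Proof. by rewrite mulr_natl -scaler_nat. Qed.

Let natM22 m (x : A) : (m%:R * x).2.2 = m%:R * x.2.2 :> C.
Proof. by rewrite mulr_natl -scaler_nat. Qed.

Let eps22 (x : A) : (((0, (0, 1)) : A) * x).2.2 = x.1.1.
Proof. by rewrite /= !mul0r mul1r !add0r. Qed.

Let horner_vcas a b w P :
  a * b = 0 -> (horner_alg (vcas q (a : A) (b : A) w) P).1.1
    = P.[casval q (w * q ^+ 2)].
Proof.
move=> ab; rewrite !horner_alg_dualnum1 horner_alg_regular /vcas ab addr0 /=.
by rewrite [_ *: _]mulr1.
Qed.

(** [cas] acts on [f] as a scalar, so the corner is the line through [f]; the trace of the
    undeformed module is nonzero on it. *)
Lemma slf_dim_edge eps s : eps ^+ 2 = 1 ->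
  basic_idem R hp s = e R hp eps p ->
  casval q (weight p eps p * q ^+ 2) = beta R p s ->
  slf_dim (B R hp s) 1.
Proof.
move=> eps2 fE cE; have [h [eE hc ek]] := e_top hp eps2.
rewrite eE in fE ek; rewrite cE in hc ek; set w := weight p eps p in cE fE ek.
have w1 : w ^+ (2 * p) = 1 := weight1 hp eps2 p.
have w2 : w ^+ 2 = q ^+ (2 * p.-1) := weight2 p eps2 p.
set f := ev h * wt p K w in fE ek.
have fk : killed q E F K Ki (beta R p s) 1 f by rewrite /killed expr1.
have [v vE] := ev_wt_self hp q_prim KX KKi KiK KE KF EF ind w1 hc fk.
have Bc x : B R hp s x <-> exists z, x = f * z * f.
  rewrite -fE; apply: (@B_corner s 1 (ev v * f)); rewrite ?fE //.
  by rewrite mulrA -rmorphM mulrC rmorphM -mulrA fk mulr0.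
have fB : B R hp s f.
  apply/Bc; exists (ev v).
  by rewrite -(ev_comm hp q_prim KKi KiK KE KF EF ind) vE.
have pp : (0 < p <= p)%N by rewrite /= leqnn.
have [tau [tauD tauZ tau_wt tau_sym _]] :=
  verma_trace hp (a := 0 : A) (b := 0) pp w1 w2
    (or_intror erefl) (or_intror erefl).
pose phi (x : U) : C := (tau predT x).1.1.
apply: (@slf_dim_of_dual _ _ _ 1 (fun=> phi) (fun=> f))
  => [_|_||psi psi_slf psi0].
- exact: (@trace_slf (tau predT) (fun y => y.1.1)).
- exact: fB.
- rewrite det_mx11 mxE /phi /f.
  have := tau_wt predT h ord0; rewrite muln0 expr0 divr1 mulr1n => ->.
  by rewrite natM11 horner_vcas ?mul0r // cE mulf_neq0.
- move=> y /Bc[z ->].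
  have [P ->] := ev_wt_corner hp q_prim EX FX KX KKi KiK KE KF EF ind h z w1.
  (* The summand [f] gives the multiple of [f] the shape of the linearity clause in [is_slf]. *)
  have [d ->] : exists d, ev P * f = d *: f + f.
    exists (P.[beta R p s] - 1); rewrite scalerBl scale1r subrK.
    exact: killed_ev1.
  by rewrite psi_slf.1 // (psi0 ord0) mulr0 addr0.
Qed.

Let weight_pos s : (0 < s)%N -> weight p 1 s = q ^+ s / q.
Proof.
by case: s => // s _; rewrite /weight mul1r exprSr mulfK // (q_neq0 hp q_prim).
Qed.

(** The sign is absorbed by [q ^+ p = -1]. For [s > 0] the weight of [e (-1) (p - s)] is thus that
    of [e 1 s] lowered by [s] steps, and both occur in one Verma module. *)
Let weight_neg s : (s < p)%N -> weight p (-1) (p - s) = q ^- s / q.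
Proof.
move=> sp; have q0 := q_neq0 hp q_prim.
apply: (mulIf (expf_neq0 s q0)); apply: (mulIf q0).
have -> : q ^- s / q * q ^+ s * q = 1 by field; rewrite q0 expf_neq0.
rewrite /weight mulN1r !mulNr -exprD -exprSr -[RHS]opprK -(qp R hp).
congr (- _ ^+ _).
by clear -sp; lia.
Qed.

Lemma casval_weight_pos s : (0 < s)%N ->
  casval q (weight p 1 s * q ^+ 2) = beta R p s.
Proof.
move=> s0; rewrite weight_pos // /casval /beta.
have q0 := q_neq0 hp q_prim; have qs0 := expf_neq0 s q0.
by congr (_ / _); field; rewrite q0 qs0.
Qed.

Lemma casval_weight_neg s : (s < p)%N ->
  casval q (weight p (-1) (p - s) * q ^+ 2) = beta R p s.
Proof.
move=> sp; rewrite weight_neg // /casval /beta.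
have q0 := q_neq0 hp q_prim; have qs0 := expf_neq0 s q0.
by congr (_ / _); field; rewrite q0 qs0.
Qed.

(** The three functions are the block traces [tau] at [a = b = 0] and the [a b] coefficient of the
    deformed full trace [rho], tested on [f1], [f2] and [y1]. *)
Lemma slf_dim_middle s : (0 < s < p)%N -> slf_dim (B R hp s) 3.
Proof.
move=> sp; have [s0 s_lt] := andP sp.
have one2 : (1 : C) ^+ 2 = 1 by rewrite expr1n.
have mone2 : (-1 : C) ^+ 2 = 1 by rewrite sqrrN.
have sp' : (0 < p - s < p)%N by clear -sp; lia.
have [h [e1 hc k1]] := e_middle hp one2 sp.
have [h' [e2 h'c k2]] := e_middle hp mone2 sp'.
rewrite e1 casval_weight_pos // in k1 hc.
rewrite e2 casval_weight_neg // in k2 h'c.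
set w := weight p 1 s in e1 k1; set w' := weight p (-1) (p - s) in e2 k2.
have w1 : w ^+ (2 * p) = 1 := weight1 hp one2 s.
have w2 : w ^+ 2 = q ^+ (2 * s.-1) := weight2 p one2 s.
have cE : casval q (w * q ^+ 2) = beta R p s by exact: casval_weight_pos.
have w'E : w' = w / q ^+ (2 * s).
  rewrite /w' /w weight_neg // weight_pos // mul2n -addnn exprD.
  have q0 := q_neq0 hp q_prim; have qs0 := expf_neq0 s q0.
  by field; rewrite q0 qs0.
rewrite w'E in e2 k2; rewrite -cE in k1 k2 hc h'c.
set f1 := ev h * wt p K w in e1 k1.
set f2 := ev h' * wt p K (w / q ^+ (2 * s)) in e2 k2.
have fE : basic_idem R hp s = f1 + f2.
  by rewrite /basic_idem gtn_eqF // ltn_eqF // e1 e2.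
have [t [tf [ft tk]]] :=
  two_weights_absorb hp q_prim KX KKi KiK KE KF EF ind sp w1 hc h'c k1 k2.
have Bc x : B R hp s x <-> exists z, x = (f1 + f2) * z * (f1 + f2).
  rewrite -fE; apply: (@B_corner s 2 t); first by rewrite fE.
  by rewrite -cE.
have s_le : (0 < s <= p)%N by rewrite s0 ltnW.
(* The basis vectors of weights [w] and [w / q ^+ (2 * s)], one in each block. *)
pose i0 : 'I_p := ord0; pose j0 : 'I_p := Ordinal s_lt.
pose a : A := ((0, 1), 0); pose b : A := (0, (1, 0)).
have [tau [tauD tauZ tau_wt _ tau_sym]] :=
  verma_trace hp (a := 0 : A) (b := 0) s_le w1 w2
    (or_intror erefl) (or_intror erefl).
have aa : a * a = 0.
  apply: (f_equal2 pair); rewrite /= ?mulr0 ?mul0r ?addr0 //.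
  by apply: (f_equal2 pair); rewrite /= ?mulr0 ?mul0r ?addr0.
have abE : a * b = (0, (0, 1)).
  apply: (f_equal2 pair); rewrite /= ?mulr0 // addr0.
  by apply: (f_equal2 pair); rewrite /= ?mulr1 ?mul0r ?mulr0 ?add0r.
have bb : b * b = 0 by apply: (f_equal2 pair); rewrite /= ?mulr0 ?mul0r ?addr0.
have [rho [rhoD rhoZ rho_wt rho_sym _]] :=
  verma_trace hp s_le w1 w2
    (or_introl (conj s_lt aa)) (or_introl (conj s_lt bb)).
have tau_low x y := (tau_sym erefl erefl x y).1.
have tau_high x y := (tau_sym erefl erefl x y).2.
pose y1 := ev ('X - (casval q (w * q ^+ 2))%:P) * f1.
pose phi (i : 'I_3) : U -> C := match val i with
  | 0 => fun x => (tau (fun i => (i < s)%N) x).1.1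
  | 1 => fun x => (tau (fun i => (s <= i)%N) x).1.1
  | _ => fun x => (rho predT x).2.2 end.
pose x (j : 'I_3) : U := match val j with 0 => f1 | 1 => f2 | _ => y1 end.
apply: (@slf_dim_of_dual _ _ _ 3 phi x) => [i|j||psi psi_slf psi0].
- case: i => [[|[|i]] hi]; rewrite /phi /=.
  + exact: (@trace_slf (tau _) (fun y => y.1.1)).
  + exact: (@trace_slf (tau _) (fun y => y.1.1)).
  + exact: (@trace_slf (rho predT) (fun y => y.2.2)).
- have mem := two_weights_mem hp q_prim KX KKi KiK KE KF EF ind
    sp w1 hc h'c k1 k2.
  apply/Bc; case: j => [[|[|j]] hj]; rewrite /x /=; last exact: (mem _).1.
    by have := (mem 1).1; rewrite rmorph1 mul1r.
  by have := (mem 1).2; rewrite rmorph1 mul1r.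
- have f1_wt : f1 = ev h * wt p K (w / q ^+ (2 * i0)).
    by rewrite muln0 expr0 divr1.
  have y1_wt : y1 = ev (('X - (casval q (w * q ^+ 2))%:P) * h) *
      wt p K (w / q ^+ (2 * i0)).
    by rewrite muln0 expr0 divr1 rmorphM -mulrA.
  have f2_wt : f2 = ev h' * wt p K (w / q ^+ (2 * j0)) by rewrite /f2.
  have tauE T P (i : 'I_p) : (tau T (ev P * wt p K (w / q ^+ (2 * i)))).1.1
      = ((2 * p)%:R * P.[casval q (w * q ^+ 2)]) *+ T i.
    rewrite tau_wt; case: (T i); rewrite ?mulr0n // !mulr1n natM11.
    by rewrite horner_vcas ?mulr0.
  have rhoE : (rho predT y1).2.2 = (2 * p)%:R * h.[casval q (w * q ^+ 2)].
    (* The shifted Casimir element acts as [a b], and multiplication by [a b] retains only the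
       constant term of the other factor. *)
    have hE : horner_alg (vcas q a b w) (('X - (casval q (w * q ^+ 2))%:P) * h)
        = a * b * horner_alg (vcas q a b w) h.
      rewrite rmorphM rmorphB /= horner_algX horner_algC; congr (_ * _).
      by rewrite /vcas addrC addKr.
    rewrite y1_wt rho_wt mulr1n natM22 hE abE eps22; congr (_ * _).
    rewrite !horner_alg_dualnum1 horner_alg_regular /vcas abE.
    by congr (_.[_]); rewrite /= addr0 [_ *: _]mulr1.
  (* The matrix is lower triangular: [f2] has no trace in the low block, and [y1] has block traces
     zero because its polynomial vanishes at the undeformed Casimir value. *)
  rewrite det_trig; last first.
    apply/is_trig_mxP => i j ij; rewrite mxE /phi /x.
    case: i j ij => [[|[|[|i]]] hi] [[|[|[|j]]] hj] //= _.
    + by rewrite f2_wt tauE /= ltnn.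
    + by rewrite y1_wt tauE hornerM hornerXsubC subrr mul0r mulr0 mul0rn.
    + by rewrite y1_wt tauE hornerM hornerXsubC subrr mul0r mulr0 mul0rn.
  rewrite !big_ord_recl big_ord0 !mxE /phi /x /= rhoE f1_wt f2_wt !tauE /=.
  by rewrite s0 leqnn !mulr1n !mulf_neq0 ?oner_eq0.
- move=> y /Bc[z ->]; apply: (psi_eq0 hp q_prim EX FX KX KKi KiK KE KF EF ind sp
    w1 w2 hc h'c k1 k2).
  + by move=> d x1 x2 /Bc Bx1 /Bc Bx2; rewrite psi_slf.1.
  + by move=> x1 x2 /Bc Bx1 /Bc Bx2; rewrite psi_slf.2.
  + exact: (psi0 ord0).
  + exact: (psi0 (Ordinal (isT : (1 < 3)%N))).
  + exact: (psi0 ord_max).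
Qed.

End Dimensions.

Theorem proposition4p4 (R : realType) (p : nat) (hp : (2 <= p)%N) :
  (forall s : nat, (1 <= s <= p - 1)%N -> slf_dim (B R hp s) 3) /\
  slf_dim (B R hp 0) 1 /\ slf_dim (B R hp p) 1.
Proof.
case: p hp => [|[|n]] // hp; split=> [s sp|]; last split.
- by apply: slf_dim_middle; lia.
- apply: (slf_dim_edge (eps := -1)); rewrite ?sqrrN ?expr1n //.
  (* Reading [p] as [p - 0] makes this the case [s = 0] of [casval_weight_neg]. *)
  by rewrite -[in weight _ _ _](subn0 n.+2) casval_weight_neg.
- apply: (slf_dim_edge (eps := 1)); rewrite ?expr1n //.
    by rewrite /basic_idem eqxx.
  exact: casval_weight_pos.
Qed.
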